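(* Let $p$ be a prime and let $G$ be a finite $p$-group of maximal class. Put $\mathbf{p}=p$ if $p$ is odd and $\mathbf{p}=4$ if $p=2$. Then $\exp(\nu(G))$ divides $\mathbf{p}^2\cdot\exp(G)$.
   Context: Conventions: $x^y=y^{-1}xy$ and $[x,y]=x^{-1}y^{-1}xy$. $\exp(H)$ is the exponent of $H$. The coclass of a finite $p$-group of order $p^n$ and nilpotency class $c$ is $n-c$; a $p$-group of maximal class is a finite $p$-group of coclass $1$. For a group $G$, let $\varphi:G\to G^{\varphi}$, $g\mapsto g^{\varphi}$, be an isomorphism onto a copy $G^{\varphi}$ of $G$, and define $\nu(G)$ to be the group generated by $G\cup G^{\varphi}$ (keeping all relations of $G$ and of $G^\varphi$) subject to the additional relations $[g_1,g_2^{\varphi}]^{g_3}=[g_1^{g_3},(g_2^{g_3})^{\varphi}]=[g_1,g_2^{\varphi}]^{g_3^{\varphi}}$ for all $g_1,g_2,g_3\in G$. *)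

(* Defs.v *)
From HB Require Import structures.
From mathcomp Require Import all_boot all_fingroup all_solvable.
From mathcomp Require Import boolp.

Set Implicit Arguments.
Unset Strict Implicit.
Unset Printing Implicit Defensive.

Local Open Scope quotient_scope.
Local Open Scope group_scope.

(* Groups given by generators and relations; the result may be infinite, so   *)
(* it is a [groupType] (and not a [finGroupType]).                            *)

Inductive gterm (X : Type) : Type :=
| GGen of X
| GOne
| GInv of gterm X
| GMul of gterm X & gterm X.
Arguments GOne {X}.

HB.instance Definition _ (X : Type) := gen_eqMixin (gterm X).
HB.instance Definition _ (X : Type) := gen_choiceMixin (gterm X).
(* This makes the library notations [x ^ y] and [[~ x, y]] available on       *)
(* terms, where they unfold to y^-1 * (x * y) and x^-1 * (y^-1 * (x * y)).    *)
HB.instance Definition _ (X : Type) := hasMul.Build (gterm X) (@GMul X).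
HB.instance Definition _ (X : Type) := hasOne.Build (gterm X) GOne.
HB.instance Definition _ (X : Type) := hasInv.Build (gterm X) (@GInv X).

Section Presentation.
Variables (X : Type) (R : gterm X -> gterm X -> Prop).
Implicit Types s t u v : gterm X.

Inductive gcong : gterm X -> gterm X -> Prop :=
| GC_rel s t : R s t -> gcong s t
| GC_refl s : gcong s s
| GC_sym s t : gcong s t -> gcong t s
| GC_trans s t u : gcong s t -> gcong t u -> gcong s u
| GC_inv s t : gcong s t -> gcong s^-1 t^-1
| GC_mul s t u v : gcong s t -> gcong u v -> gcong (s * u) (t * v)
| GC_mulA s t u : gcong (s * (t * u)) (s * t * u)
| GC_mul1g s : gcong (1 * s) s
| GC_mulg1 s : gcong (s * 1) s
| GC_mulVg s : gcong (s^-1 * s) 1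
| GC_mulgV s : gcong (s * s^-1) 1.

Definition gcongb s t : bool := `[< gcong s t >].

Fact gcongb_refl : reflexive gcongb.
Proof. by move=> s; apply/asboolP/GC_refl. Qed.

Fact gcongb_sym : symmetric gcongb.
Proof. by move=> s t; apply/asboolP/asboolP; apply: GC_sym. Qed.

Fact gcongb_trans : transitive gcongb.
Proof.
by move=> t s u /asboolP st /asboolP tu; apply/asboolP; apply: GC_trans st tu.
Qed.

Canonical gcong_equiv := EquivRel gcongb gcongb_refl gcongb_sym gcongb_trans.

Definition presented : Type := {eq_quot gcong_equiv}.
HB.instance Definition _ := Choice.on presented.

Definition pclass (s : gterm X) : presented := \pi_{eq_quot gcong_equiv} s.
Definition prepr (a : presented) : gterm X :=
  @generic_quotient.repr _ {eq_quot gcong_equiv} a.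

Fact preprK : cancel prepr pclass.
Proof. exact: (@reprK _ {eq_quot gcong_equiv}). Qed.

Lemma pclassP s t : pclass s = pclass t <-> gcong s t.
Proof.
by split=> [/eqquotP/asboolP //|st]; apply/eqquotP/asboolP.
Qed.

Fact prepr_pclass s : gcong (prepr (pclass s)) s.
Proof. by apply/pclassP; rewrite preprK. Qed.

Definition pone : presented := pclass 1.
Definition pinv (a : presented) : presented := pclass (prepr a)^-1.
Definition pmul (a b : presented) : presented := pclass (prepr a * prepr b).

Fact pinvE s : pinv (pclass s) = pclass s^-1.
Proof. by apply/pclassP/GC_inv/prepr_pclass. Qed.

Fact pmulE s t : pmul (pclass s) (pclass t) = pclass (s * t).
Proof. by apply/pclassP/GC_mul; apply: prepr_pclass. Qed.

Fact pmulA : associative pmul.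
Proof.
move=> a b c; rewrite -(preprK a) -(preprK b) -(preprK c) !pmulE.
exact/pclassP/GC_mulA.
Qed.

Fact pmul1g : left_id pone pmul.
Proof. by move=> a; rewrite -(preprK a) pmulE; apply/pclassP/GC_mul1g. Qed.

Fact pmulg1 : right_id pone pmul.
Proof. by move=> a; rewrite -(preprK a) pmulE; apply/pclassP/GC_mulg1. Qed.

Fact pmulVg : left_inverse pone pinv pmul.
Proof.
by move=> a; rewrite -(preprK a) pinvE pmulE; apply/pclassP/GC_mulVg.
Qed.

Fact pmulgV : right_inverse pone pinv pmul.
Proof.
by move=> a; rewrite -(preprK a) pinvE pmulE; apply/pclassP/GC_mulgV.
Qed.

HB.instance Definition _ :=
  isGroup.Build presented pmulA pmul1g pmulg1 pmulVg pmulgV.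

Lemma pclassM s t : pclass (s * t) = pclass s * pclass t.
Proof. by rewrite -pmulE. Qed.

Lemma pclassV s : pclass s^-1 = (pclass s)^-1.
Proof. by rewrite -pinvE. Qed.

Lemma pclass1 : pclass 1 = 1.
Proof. by []. Qed.

Section UniversalProperty.
Variables (H : groupType) (f : X -> H).

Fixpoint geval (s : gterm X) : H :=
  match s with
  | GGen x => f x
  | GOne => 1
  | GInv s => (geval s)^-1
  | GMul s t => geval s * geval t
  end.

Hypothesis fR : forall s t, R s t -> geval s = geval t.

Fact geval_gcong s t : gcong s t -> geval s = geval t.
Proof.
elim=> {s t} //=.
- by move=> s t u _ -> _ ->.
- by move=> s t _ ->.
- by move=> s t u v _ -> _ ->.
- by move=> s t u; rewrite mulgA.
- by move=> s; rewrite mul1g.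
- by move=> s; rewrite mulg1.
- by move=> s; rewrite mulVg.
- by move=> s; rewrite mulgV.
Qed.

Definition plift (a : presented) : H := geval (prepr a).

Lemma pliftE s : plift (pclass s) = geval s.
Proof. exact/geval_gcong/prepr_pclass. Qed.

Lemma pliftM : {morph plift : a b / a * b}.
Proof.
by move=> a b; rewrite -(preprK a) -(preprK b) -pclassM !pliftE.
Qed.

End UniversalProperty.

End Presentation.

Section Nu.
Variable G : groupType.

(* [inl g] stands for g and [inr g] for its copy g^phi; the multiplication    *)
(* tables are the relations of G and of G^phi.                                *)
Definition nu_in (g : G) : gterm (G + G) := GGen (inl g).
Definition nu_phi (g : G) : gterm (G + G) := GGen (inr g).

Inductive nu_rel : gterm (G + G) -> gterm (G + G) -> Prop :=
| NuMul g h : nu_rel (nu_in g * nu_in h) (nu_in (g * h))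
| NuMulPhi g h : nu_rel (nu_phi g * nu_phi h) (nu_phi (g * h))
| NuConj g1 g2 g3 :
    nu_rel ([~ nu_in g1, nu_phi g2] ^ nu_in g3)
           [~ nu_in (g1 ^ g3), nu_phi (g2 ^ g3)]
| NuConjPhi g1 g2 g3 :
    nu_rel [~ nu_in (g1 ^ g3), nu_phi (g2 ^ g3)]
           ([~ nu_in g1, nu_phi g2] ^ nu_phi g3).

Definition nu : groupType := presented nu_rel.

End Nu.

Section Exponent.
Variable H : groupType.

Definition exponent_bound (n : nat) : bool :=
  (0 < n)%N && `[< forall x : H, x ^+ n = 1 >].

(* The least n > 0 such that x ^+ n = 1 for all x, and 0 if there is none; in *)
(* the latter case the exponent divides no positive integer.                  *)
Definition group_exponent : nat :=
  if pselect (exists n, exponent_bound n) is left ex then ex_minn ex else 0%N.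

Lemma group_exponent_dvdn n : (0 < n)%N ->
  (group_exponent %| n)%N <-> (forall x : H, x ^+ n = 1).
Proof.
move=> n_gt0; rewrite /group_exponent; case: pselect => [ex|noex]; last first.
  split=> [|xn1]; first by rewrite dvd0n => /eqP n0; rewrite n0 in n_gt0.
  by case: noex; exists n; rewrite /exponent_bound n_gt0; apply/asboolP.
case: ex_minnP => m /andP[m_gt0 /asboolP xm1] min_m; split.
  by move=> /dvdnP[k ->] x; rewrite mulnC expgnA xm1 expg1n.
move=> xn1; rewrite /dvdn; case: (posnP (n %% m)%N) => [//|r_gt0].
have /min_m : exponent_bound (n %% m)%N.
  rewrite /exponent_bound r_gt0; apply/asboolP => x.
  by rewrite -(xn1 x) {2}(divn_eq n m) expgnDr mulnC expgnA xm1 expg1n mul1g.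
by rewrite leqNgt ltn_mod m_gt0.
Qed.

End Exponent.

Section MaximalClass.
Variables (gT : finGroupType) (p : nat) (G : {group gT}).

(* The subtraction is not truncated: a group of order p ^ n has class <= n.   *)
Definition coclass : nat := (logn p #|G| - nil_class G)%N.

Definition maximal_class : bool := p.-group G && (coclass == 1%N).

End MaximalClass.

Definition bold_p (p : nat) : nat := if p == 2%N then 4%N else p.

(* Main.v *)
(* Let |G| = p ^ n, let L k denote the lower central series and H = nu G.

   Powers.  By Hall's collection formula, x ^ q lies in L (i + r - 1) for every
   x in L i as soon as the q-th powers of a set of generators lie in L r and q
   divides the binomials C(q, j), 0 < j < r.  The formula is obtained from
   Leibman's theorem that polynomial sequences in a filtered group are closed
   under products: n |-> (x ^ n y ^ n)^-1 (x y) ^ n is such a sequence, and its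
   Taylor coefficients are the commutator factors.

   Class.  In H one has [[a, b], c'] = [[a, b'], c'] (primes for copies under
   phi), whence L (n + 1) of H is trivial when L n of G is.

   If n <= p, then x ^ exp(G) is in L p of H, and the (p ^ 2)-th power of that
   is in L (p + 1), hence trivial.

   If n > p, a group is not the union of p proper subgroups, so there are
   enough elements s outside the two-step centralizers
   C k = C_G(L k / L (k + 2)).  They generate G and satisfy s ^ p \in L p, so
   x ^ (p ^ m) is in L (1 + m (p - 1)) for all x in H.  Conversely, for i > p,
   p-th powers carry L i \ L (i + 1) into L (i + p - 1) \ L (i + p): otherwise
   L i / L (i + p) has exponent p and [a, s ^ p] = [a, s, ..., s] mod L (i + p)
   for a in L (i - 1), with the left side in L (i + p) and the right side not.
   Hence n <= p + 1 + e (p - 1) if exp(G) = p ^ e, which gives the bound. *)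

Require Import Defs.
From mathcomp Require Import all_boot all_fingroup all_solvable.
From mathcomp Require Import boolp ssralg.
From mathcomp Require Import zify.

Set Implicit Arguments.
Unset Strict Implicit.
Unset Printing Implicit Defensive.

Local Open Scope group_scope.

Ltac group_norm := rewrite /commg /conjg; repeat rewrite
  ?invgM ?invgK ?mulgA ?mulgK ?mulgVK ?mulVg ?mulgV ?mul1g ?mulg1 ?invg1.

Ltac nat_lia :=
  repeat match goal with
  | H : ?T |- _ =>
    lazymatch T with
    | nat => first [clearbody H | fail]
    | is_true (leq _ _) => fail
    | @eq nat _ _ => fail
    | _ => clear H
    end
  end; lia.

Lemma addn_leq_muln m n : 1 < m -> 1 < n -> m + n <= m * n.
Proof. nia. Qed.

(** * Subgroups and commutators in possibly infinite groups *)

Section Subgroups.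
Variable K : groupType.
Implicit Types (x y z : K) (A B S T : K -> Prop).

(** Predicates, since [nu G] is not known to be finite. *)
Record is_subgroup A : Prop := IsSubgroup {
  subgroup1 : A 1;
  subgroupM : forall x y, A x -> A y -> A (x * y);
  subgroupV : forall x, A x -> A x^-1 }.

Definition is_normal A := forall x y, A x -> A (x ^ y).

Lemma subgroupX A n x : is_subgroup A -> A x -> A (x ^+ n).
Proof.
move=> gA Ax; elim: n => [|n IHn]; first exact: subgroup1.
by rewrite expgS; apply: subgroupM.
Qed.

Lemma subgroupMl A x y : is_subgroup A -> A x -> A (x * y) -> A y.
Proof.
by move=> gA Ax /(subgroupM gA (subgroupV gA Ax)); rewrite mulKg.
Qed.

Lemma subgroupMr A x y : is_subgroup A -> A y -> A (x * y) -> A x.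
Proof.
by move=> gA Ay Axy; have := subgroupM gA Axy (subgroupV gA Ay); rewrite mulgK.
Qed.

Lemma conj_mulR x y : x ^ y = x * [~ x, y].
Proof. by rewrite /commg mulgA mulgV mul1g. Qed.

Lemma commMgJ x y z : [~ x * y, z] = [~ x, z] ^ y * [~ y, z].
Proof. by group_norm. Qed.

Lemma commgMJ x y z : [~ x, y * z] = [~ x, z] * [~ x, y] ^ z.
Proof. by group_norm. Qed.

Lemma comm_norml A x y : is_subgroup A -> is_normal A -> A x -> A [~ x, y].
Proof.
by move=> gA nA Ax; rewrite commgEl; apply: (subgroupM gA); [apply: subgroupV|apply: nA].
Qed.

Lemma comm_normr A x y : is_subgroup A -> is_normal A -> A y -> A [~ x, y].
Proof.
by move=> gA nA Ay; rewrite -invgR; apply: subgroupV => //; apply: comm_norml.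
Qed.

Inductive gen S : K -> Prop :=
| gen_incl x : S x -> gen S x
| gen_one : gen S 1
| gen_mul x y : gen S x -> gen S y -> gen S (x * y)
| gen_inv x : gen S x -> gen S x^-1.

Lemma gen_subgroup S : is_subgroup (gen S).
Proof. by split; [apply: gen_one|apply: gen_mul|apply: gen_inv]. Qed.

Lemma gen_sub S A : is_subgroup A -> (forall x, S x -> A x) ->
  forall x, gen S x -> A x.
Proof.
move=> gA SA x; elim=> {x} [x /SA //||x y _ Ax _ Ay|x _ Ax].
- exact: subgroup1.
- exact: subgroupM.
- exact: subgroupV.
Qed.

Lemma gen_normal S : (forall x y, S x -> gen S (x ^ y)) -> is_normal (gen S).
Proof.
move=> nS x z; elim=> {x} [x /nS //||x y _ Ax _ Ay|x _ Ax].
- by rewrite conj1g; apply: gen_one.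
- by rewrite conjMg; apply: gen_mul.
- by rewrite conjVg; apply: gen_inv.
Qed.

Lemma gen_commr S T y : is_subgroup T -> is_normal T ->
  (forall x, S x -> T [~ x, y]) -> forall x, gen S x -> T [~ x, y].
Proof.
move=> gT nT ST x; elim=> {x} [x /ST //||x z _ Tx _ Tz|x _ Tx].
- by rewrite comm1g; apply: subgroup1.
- by rewrite commMgJ; apply: subgroupM => //; apply: nT.
- suff -> : [~ x^-1, y] = ([~ x, y] ^ x^-1)^-1.
    by apply: subgroupV => //; apply: nT.
  by group_norm.
Qed.

Lemma gen_comm S1 S2 T : is_subgroup T -> is_normal T ->
  (forall x y, S1 x -> S2 y -> T [~ x, y]) ->
  forall x y, gen S1 x -> gen S2 y -> T [~ x, y].
Proof.
move=> gT nT ST x y S1x S2y; apply: gen_commr S1x => // {}x S1x.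
rewrite -invgR; apply: subgroupV => //; apply: gen_commr S2y => // {}y S2y.
by rewrite -invgR; apply: subgroupV => //; apply: ST.
Qed.

End Subgroups.

(** * Polynomial sequences in filtered groups *)

Section PolynomialSequences.
Variables (K : groupType) (r : nat) (F : nat -> K -> Prop).
Hypothesis subgroupF : forall d, is_subgroup (F d).
Hypothesis antiF : forall d x, F d.+1 x -> F d x.
Hypothesis commF : forall d e x y, F d x -> F e y -> F (d + e) [~ x, y].
Implicit Types f g h : nat -> K.

Definition dleft f n := (f n)^-1 * f n.+1.
Definition dright f n := f n.+1 * (f n)^-1.

(* Asking for both one-sided derivatives makes inverses of polynomial sequences
   trivially polynomial, as inversion exchanges them. *)
Fixpoint poly_rec m d f := (forall n, F d (f n)) /\
  if m is m'.+1 then poly_rec m' d.+1 (dleft f) /\ poly_rec m' d.+1 (dright f)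
  else True.
(** Derivatives are tested up to order [r - d], where values must lie in [F r]; for [d >= r] only
    the values of [f] are restricted. *)
Definition poly d f := poly_rec (r - d) d f.

Lemma polyF d f n : poly d f -> F d (f n).
Proof. by rewrite /poly; case: (r - d) => [|m] /= []. Qed.

Lemma poly_leq d f : r <= d -> (forall n, F d (f n)) -> poly d f.
Proof. by rewrite /poly -subn_eq0 => /eqP->. Qed.

Lemma polyS d f : d < r -> poly d f <->
  [/\ forall n, F d (f n), poly d.+1 (dleft f) & poly d.+1 (dright f)].
Proof.
move=> ltdr; rewrite /poly -(subnSK ltdr) /=.
by split=> [[? []] | []]; split.
Qed.

Lemma poly_ind (P : nat -> Prop) :
  (forall d, r <= d -> P d) -> (forall d, d < r -> P d.+1 -> P d) ->
  forall d, P d.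
Proof.
move=> P0 PS d; have [m] := ubnP (r - d); elim: m d => // m IHm d lt_m.
have [/P0 // | ltdr] := leqP r d.
by apply: PS => //; apply: IHm; lia.
Qed.

Lemma poly_anti d f : poly d.+1 f -> poly d f.
Proof.
move: d f; apply: poly_ind => d => [le_rd|lt_dr IHd] f Pf.
  by apply: poly_leq => // n; apply/antiF/polyF.
apply/polyS => //; split=> [n||]; first exact/antiF/polyF.
  have [lt_d1r|le_rd1] := ltnP d.+1 r.
    by apply: IHd; case/polyS: Pf.
  by apply: poly_leq => // n; apply: (subgroupM (subgroupF _));
    [apply: (subgroupV (subgroupF _))|]; apply: polyF.
have [lt_d1r|le_rd1] := ltnP d.+1 r.
  by apply: IHd; case/polyS: Pf.
by apply: poly_leq => // n; apply: (subgroupM (subgroupF _));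
  [|apply: (subgroupV (subgroupF _))]; apply: polyF.
Qed.

Lemma poly_antiD e d f : poly (d + e) f -> poly d f.
Proof. by elim: e => [|e IHe]; rewrite ?addn0 // addnS => /poly_anti. Qed.

Lemma poly_ext d f g : f =1 g -> poly d f -> poly d g.
Proof.
rewrite /poly; move: (r - d) => k; elim: k d f g => [|m IHm] d f g eq_fg /= [Ff Df].
  by split=> // n; rewrite -eq_fg.
have [Dl Dr] := Df; split=> [n|]; first by rewrite -eq_fg.
by split; [apply: IHm Dl|apply: IHm Dr] => n; rewrite /dleft /dright !eq_fg.
Qed.

Lemma poly_inv d f : poly d f -> poly d (fun n => (f n)^-1).
Proof.
move: d f; apply: poly_ind => d => [le_rd|lt_dr IHd] f Pf.
  by apply: poly_leq => // n; apply: (subgroupV (subgroupF _)); apply: polyF.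
have [Ff Dl Dr] := (polyS f lt_dr).1 Pf.
apply/polyS => //; split=> [n||]; first by apply: (subgroupV (subgroupF _)).
  apply: (@poly_ext _ (fun n => (dright f n)^-1)); last exact: IHd.
  by move=> n; rewrite /dright /dleft; group_norm.
apply: (@poly_ext _ (fun n => (dleft f n)^-1)); last exact: IHd.
by move=> n; rewrite /dright /dleft; group_norm.
Qed.

Lemma poly_shift d f : poly d f -> poly d (fun n => f n.+1).
Proof.
rewrite /poly; move: (r - d) => k; elim: k d f => [|m IHm] d f /= [Ff Df]; first by split.
have [Dl Dr] := Df; split=> //.
by split; [apply: (IHm _ (dleft f) Dl)|apply: (IHm _ (dright f) Dr)].
Qed.

Let mulP k := forall f g, poly k f -> poly k g -> poly k (fun n => f n * g n).
Let commP k := forall d e f g, d + e = k ->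
  poly d f -> poly e g -> poly k (fun n => [~ f n, g n]).

Let conj_poly k d f g : mulP k -> commP (k + d) ->
  poly k f -> poly d g -> poly k (fun n => f n ^ g n).
Proof.
move=> Mk Ck Pf Pg; apply: (@poly_ext _ (fun n => f n * [~ f n, g n])).
  by move=> n; rewrite conj_mulR.
by apply: Mk => //; apply: (@poly_antiD d); apply: Ck Pf Pg.
Qed.

(* Products and commutators are treated together, by downward induction on the
   degree.  The Hall-Witt identity for f, g and the shift operator expresses the
   derivatives of [f, g] through commutators of f or g with derivatives of the
   other, of which only conjugates by f and g are needed. *)
Lemma poly_mul_comm k : mulP k /\ forall l, k <= l -> commP l.
Proof.
move: k; apply: poly_ind => k.
  move=> le_rk; split=> [f g Pf Pg|l le_kl d e f g deE Pf Pg].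
    by apply: poly_leq => // n; apply: (subgroupM (subgroupF _)); apply: polyF.
  apply: poly_leq => [|n]; first exact: leq_trans le_kl.
  by rewrite -deE; apply: commF; apply: polyF.
move=> lt_kr [Mk1 Ck1].
have Jk d f g : poly k.+1 f -> poly d g -> poly k.+1 (fun n => f n ^ g n).
  by apply: conj_poly => //; apply: Ck1; rewrite leq_addr.
(* Leibniz rules: up to conjugation, the derivatives of a product are products of derivatives. *)
have Mk : mulP k.
  move=> f g Pf Pg; have [Ff fl fr] := (polyS f lt_kr).1 Pf.
  have [Fg gl gr] := (polyS g lt_kr).1 Pg.
  apply/polyS => //; split=> [n||]; first by apply: (subgroupM (subgroupF _)).
    apply: (@poly_ext _ (fun n => dleft f n ^ g n * dleft g n)).
      by move=> n; rewrite /dleft; group_norm.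
    by apply: Mk1 => //; apply: Jk Pg.
  apply: (@poly_ext _ (fun n => dright f n * dright g n ^ (f n)^-1)).
    by move=> n; rewrite /dright; group_norm.
  by apply: Mk1 => //; apply: Jk (poly_inv Pf).
split=> // l; rewrite leq_eqVlt => /predU1P[<-{l}|/Ck1//] d e f g deE Pf Pg.
have [lt_dr lt_er] : d < r /\ e < r by lia.
have [Ff fl fr] := (polyS f lt_dr).1 Pf.
have [Fg gl gr] := (polyS g lt_er).1 Pg.
have C1 : poly k.+1 (fun n => [~ (g n)^-1, dright f n]).
  by apply: (Ck1 k.+1 _ e d.+1) (poly_inv Pg) fr; lia.
have C2 : poly k.+1 (fun n => [~ f n.+1, dright g n]).
  by apply: (Ck1 k.+1 _ d e.+1) (poly_shift Pf) gr; lia.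
apply/polyS => //; split=> [n||]; first by rewrite -deE; apply: commF.
  apply: (@poly_ext _ (fun n => ([~ (g n)^-1, dright f n] ^ f n *
                                 [~ f n.+1, dright g n]) ^ g n)).
    by move=> n; rewrite /dleft /dright; group_norm.
  by apply: (Jk e) Pg; apply: Mk1 => //; apply: (Jk d).
apply: (@poly_ext _ (fun n => (([~ (g n)^-1, dright f n] *
                                [~ f n.+1, dright g n] ^ (f n)^-1) ^ g n) ^ f n)).
  by move=> n; rewrite /dleft /dright; group_norm.
apply: (Jk d) (Pf); apply: (Jk e) (Pg); apply: Mk1 => //.
by apply: (Jk d) (poly_inv Pf).
Qed.

Lemma poly_mul d f g : poly d f -> poly d g -> poly d (fun n => f n * g n).
Proof. by case: (poly_mul_comm d) => M _; apply: M. Qed.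

Lemma poly_one d : poly d (fun=> 1).
Proof.
move: d; apply: poly_ind => d; first by move=> le_rd; apply: poly_leq => // n; apply: subgroup1.
move=> lt_dr P1; apply/polyS => //; split=> [n||]; first exact: subgroup1.
  by apply: poly_ext P1 => n; rewrite /dleft mulVg.
by apply: poly_ext P1 => n; rewrite /dright mulgV.
Qed.

(** By Pascal's rule both derivatives of [c ^+ 'C(n, j.+1)] are [c ^+ 'C(n, j)]. *)
Lemma poly_binomial j d c : F (d + j) c -> poly d (fun n => c ^+ 'C(n, j)).
Proof.
have Fanti m i x : F (m + i) x -> F m x.
  by elim: i => [|i IHi]; rewrite ?addn0 // addnS => /antiF.
elim: j d => [|j IHj] d Fc.
  have [le_rd|lt_dr] := leqP r d.
    by apply: poly_leq => // n; apply: subgroupX => //; apply: Fanti Fc.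
  apply/polyS => //; split=> [n||]; first by apply: subgroupX => //; apply: Fanti Fc.
    by apply: poly_ext (poly_one _) => n; rewrite /dleft !bin0 mulVg.
  by apply: poly_ext (poly_one _) => n; rewrite /dright !bin0 mulgV.
have [le_rd|lt_dr] := leqP r d.
  by apply: poly_leq => // n; apply: subgroupX => //; apply: Fanti Fc.
have Pj : poly d.+1 (fun n => c ^+ 'C(n, j)) by apply: IHj; rewrite addSnnS.
apply/polyS => //; split=> [n||]; first by apply: subgroupX => //; apply: Fanti Fc.
  by apply: poly_ext Pj => n; rewrite /dleft binS expgnDr mulKg.
by apply: poly_ext Pj => n; rewrite /dright binS addnC expgnDr mulgK.
Qed.

Lemma poly_power d x : F d.+1 x -> poly d (fun n => x ^+ n).
Proof.
by rewrite -addn1 => /poly_binomial; apply: poly_ext => n; rewrite bin1.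
Qed.

(** Where [f] is trivial, left differentiation is a shift, so [f j] is the value at 0 of the [j]-th
    left derivative. *)
Lemma poly_lead j d f : poly d f -> (forall n, n < j -> f n = 1) ->
  d + j <= r -> F (d + j) (f j).
Proof.
elim: j d f => [|j IHj] d f Pf f1 le_djr; first by rewrite addn0; apply: polyF.
have lt_dr : d < r by lia.
have [_ Pl _] := (polyS f lt_dr).1 Pf.
rewrite -addSnnS; have -> : f j.+1 = dleft f j by rewrite /dleft (f1 j) // invg1 mul1g.
apply: IHj => // [n lt_nj|]; last by rewrite addSnnS.
by rewrite /dleft !f1 ?mulVg // ltnS ltnW.
Qed.

(** The left derivative is trivial at one point fewer, so by induction it lies in [F r]; starting
    from [f 0 = 1], so does [f]. *)
Lemma poly_vanish d f n : poly d f -> d <= r ->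
  (forall m, m < r - d -> f m = 1) -> F r (f n).
Proof.
move: d f n; apply: poly_ind => [d le_rd f n Pf le_dr _|].
  have <- : d = r by apply/eqP; rewrite eqn_leq le_dr.
  exact: polyF.
move=> d lt_dr IHd f n Pf _ f1; have [_ Pl _] := (polyS f lt_dr).1 Pf.
have Fl m : F r (dleft f m).
  apply: IHd => // k lt_k; rewrite /dleft !f1 ?mulVg //; lia.
elim: n => [|n Fn].
  by rewrite f1; [apply: (subgroup1 (subgroupF _))|lia].
rewrite -(mulVKg (f n) (f n.+1)).
by apply: (subgroupM (subgroupF _)) => //; apply: Fl.
Qed.

(* Newton's expansion: the coefficient of ['C(n, j)] is in [F j]. *)
Lemma poly_value T q f : is_subgroup T -> (forall x, F r x -> T x) ->
    (forall x, F 2 x -> T (x ^+ q)) ->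
    (forall j, 1 < j < r -> q %| 'C(q, j)) ->
  poly 0 f -> f 0 = 1 -> f 1%N = 1 -> T (f q).
Proof.
move=> gT FT FqT dvd_q Pf f0 f1.
have {f0 f1} f01 n : n < 2 -> f n = 1 by case: n => [|[]].
have [j lt_1j fj] : exists2 j, 1 < j & forall n, n < j -> f n = 1 by exists 2.
have [m] := ubnP (r - j); elim: m j f lt_1j fj {f01} Pf => // m IHm j f lt_1j fj Pf lt_m.
have [le_rj|lt_jr] := leqP r j.
  by apply/FT/(poly_vanish q Pf) => // i lt_ir; apply: fj; lia.
have Fj : F j (f j) by apply: (@poly_lead j 0) => //; rewrite ltnW.
have F2 : F 2 (f j).
  have Fanti i k x : F (k + i) x -> F k x.
    by elim: i => [|i IHi]; rewrite ?addn0 // addnS => /antiF.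
  by apply: (Fanti (j - 2)); rewrite subnKC.
(* Removing the leading Newton factor makes the sequence trivial at [j] as well. *)
set g := fun n => (f j ^+ 'C(n, j))^-1 * f n.
have -> : f q = f j ^+ 'C(q, j) * g q by rewrite mulVKg.
apply: subgroupM => //.
  by rewrite -(divnK (dvd_q j _)) ?lt_1j // mulnC expgnA; apply: subgroupX => //; apply: FqT.
apply: (IHm j.+1); [lia|move=> n| |lia]; last first.
  by apply: poly_mul => //; apply/poly_inv/poly_binomial.
rewrite ltnS leq_eqVlt => /predU1P[->|lt_nj]; first by rewrite /g binn mulVg.
by rewrite /g bin_small // invg1 mul1g fj.
Qed.

Lemma power_mul T q x y : is_subgroup T -> (forall z, F r z -> T z) ->
    (forall z, F 2 z -> T (z ^+ q)) ->
    (forall j, 1 < j < r -> q %| 'C(q, j)) ->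
  F 1 x -> F 1 y -> T ((x ^+ q * y ^+ q)^-1 * (x * y) ^+ q).
Proof.
move=> gT FT FqT dvd_q Fx Fy.
have P0 : poly 0 (fun n => (x ^+ n * y ^+ n)^-1 * (x * y) ^+ n).
  apply: poly_mul; last by apply: poly_power; apply: subgroupM.
  by apply: poly_inv; apply: poly_mul; apply: poly_power.
apply: (poly_value gT FT FqT dvd_q P0); first by group_norm.
by rewrite !expg1 mulVg.
Qed.

End PolynomialSequences.

(** * Powers along the lower central series *)

Section LowerCentral.
Variable K : groupType.
Implicit Types (x y z g h : K) (S T : K -> Prop).

(* As for ['L_n(G)], both degrees 0 and 1 denote the whole group. *)
Fixpoint lcs n : K -> Prop :=
  if n is m.+1 then
    if m is _.+1 then gen (fun z => exists x y, lcs m x /\ z = [~ x, y])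
    else fun=> True
  else fun=> True.

Lemma lcsSS n :
  lcs n.+2 = gen (fun z => exists x y, lcs n.+1 x /\ z = [~ x, y]).
Proof. by []. Qed.

Lemma lcs_subgroup n : is_subgroup (lcs n).
Proof. by case: n => [|[|n]]; [split|split|apply: gen_subgroup]. Qed.
Hint Resolve lcs_subgroup : core.

Lemma lcs_normal n : is_normal (lcs n).
Proof.
elim: n => [|[|n] IHn] //; rewrite lcsSS; apply: gen_normal => _ z [x [y [Lx ->]]].
by rewrite conjRg; apply: gen_incl; exists (x ^ z), (y ^ z); split=> //; apply: IHn.
Qed.
Hint Resolve lcs_normal : core.

Lemma lcs_commS n x y : lcs n x -> lcs n.+1 [~ x, y].
Proof. by case: n => // n Lx; apply: gen_incl; exists x, y. Qed.

Lemma lcs_anti n x : lcs n.+1 x -> lcs n x.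
Proof.
case: n => // n; rewrite lcsSS; apply: gen_sub => // _ [z [y [Lz ->]]].
exact: comm_norml.
Qed.

Lemma lcs_leq m n x : m <= n -> lcs n x -> lcs m x.
Proof.
by move/subnKC <-; elim: (n - m) => [|k IHk]; rewrite ?addn0 // addnS => /lcs_anti.
Qed.

Lemma Hall_Witt x y z :
  [~ x, y^-1, z] ^ y * [~ y, z^-1, x] ^ z * [~ z, x^-1, y] ^ x = 1.
Proof. by group_norm. Qed.

(** For a generator [[~ z, h]] of the second term, Hall-Witt expresses [[~ z, h, x]] by commutators
    that the induction hypothesis covers. *)
Lemma lcs_comm m n x y : lcs m x -> lcs n y -> lcs (m + n) [~ x, y].
Proof.
elim: n m x y => [|n IHn] m x y Lx.
  by rewrite addn0 => _; apply: comm_norml.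
case: n IHn => [|n] IHn; first by rewrite addn1 => _; apply: lcs_commS.
rewrite lcsSS => Ly; rewrite -invgR; apply: subgroupV => //.
apply: gen_commr Ly => // {y} _ [z [h [Lz ->]]].
have HW := Hall_Witt z h^-1 x; rewrite invgK in HW.
have /(can_inj (conjgK h^-1)) E : [~ z, h, x] ^ h^-1 =
    (([~ h^-1, x^-1, z] ^ x * [~ x, z^-1, h^-1] ^ z)^-1 ^ h) ^ h^-1.
  by rewrite conjgK; apply: (mulIg ([~ h^-1, x^-1, z] ^ x * [~ x, z^-1, h^-1] ^ z));
    rewrite mulVg mulgA.
rewrite E; apply: lcs_normal; apply: subgroupV => //; apply: subgroupM => //.
  apply: lcs_normal; rewrite -addSnnS; apply: IHn => //.
  by rewrite -invgR; apply: subgroupV => //; apply: lcs_commS; apply: subgroupV.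
apply: lcs_normal; rewrite addnS; apply: lcs_commS.
by apply: IHn => //; apply: subgroupV.
Qed.

(** Only [u] has to be deep, because the subgroup generated by [g] and [lcs i] is cyclic modulo
    [lcs i]. *)
Lemma lcs_power_mul i r q T g u : 0 < i ->
    is_subgroup T -> (forall x, lcs (i + r).-1 x -> T x) ->
    (forall x, lcs i.+1 x -> T (x ^+ q)) ->
    (forall j, 1 < j < r -> q %| 'C(q, j)) -> 1 < r ->
  lcs i u -> T ((g ^+ q * u ^+ q)^-1 * (g * u) ^+ q).
Proof.
move=> i_gt0 gT LT LqT dvd_q r_gt1 Lu.
pose A := gen (fun x => x = g \/ lcs i x).
have gA : is_subgroup A by apply: gen_subgroup.
have LA x : lcs i x -> A x by move=> Lx; apply: gen_incl; right.
(* Degrees 0 and 1 coincide; commutators of [A] land in [lcs i.+1], which is degree 2. *)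
pose F d := if d < 2 then A else lcs (i + d).-1.
have F2 d x : 1 < d -> F d x = lcs (i + d).-1 x by move=> d_gt1; rewrite /F ltnNge d_gt1.
have commA x y : A x -> A y -> lcs i.+1 [~ x, y].
  apply: gen_comm => // {}x {}y [->|Lx]; last by move=> _; apply: lcs_commS.
  case=> [->|Ly]; first by rewrite commgg; apply: subgroup1.
  by rewrite -invgR; apply: subgroupV => //; apply: lcs_commS.
apply: (@power_mul K r F) => //.
- by move=> d; rewrite /F; case: ifP.
- move=> [|[|d]] x //; rewrite F2 // => Lx.
    by apply/LA; apply: lcs_leq Lx; lia.
  by rewrite ?F2 //; apply: lcs_leq Lx; lia.
- move=> d e x y; case: (ltnP d 2) => [lt_d2|le_2d]; last first.
    rewrite (F2 d) // => Lx; rewrite (F2 (d + e)); last lia.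
    case: (ltnP e 2) => [lt_e2 _|le_2e].
      by apply: lcs_leq (lcs_commS y Lx); lia.
    by rewrite F2 // => Ly; apply: lcs_leq (lcs_comm Lx Ly); lia.
  case: (ltnP e 2) => [lt_e2|le_2e] Fx.
    rewrite /F lt_e2; move: Fx; rewrite {1}/F lt_d2 => Ax Ay.
    case: ifP => _; first by apply/LA/lcs_anti/commA.
    by apply: lcs_leq (commA _ _ Ax Ay); lia.
  rewrite !F2 //; last lia.
  move=> Ly; rewrite -invgR; apply: subgroupV => //.
  by apply: lcs_leq (lcs_commS x Ly); lia.
- by move=> x; rewrite ?F2 //; apply: LT.
- by move=> x; rewrite ?F2 // addn2; apply: LqT.
- by apply: gen_incl; left.
- exact: LA.
Qed.

(* If the generators have their [q]-th powers in [lcs r], the congruence      *)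
(* [[g, h] ^ q = [g ^ q, h]] spreads this along the lower central series.     *)
Lemma lcs_power r q S : 1 < r -> (forall j, 0 < j < r -> q %| 'C(q, j)) ->
    (forall x, gen S x) -> (forall x, S x -> lcs r (x ^+ q)) ->
  forall i x, 0 < i -> lcs i x -> lcs (i + r).-1 (x ^+ q).
Proof.
move=> r_gt1 dvd_q genS Sq.
have dvd_q' j : 1 < j < r -> q %| 'C(q, j) by move=> ?; apply: dvd_q; lia.
(* Truncation at [m] permits gaining one degree at a time. *)
suff IH m i x : 0 < i -> lcs i x -> lcs (minn (i + r).-1 m) (x ^+ q).
  by move=> i x i_gt0 /(IH (i + r).-1 i x i_gt0); rewrite minnn.
elim: m i x => [|m IHm] i x i_gt0 Li; first by rewrite minn0.
have [le_im|lt_mi] := leqP (i + r).-1 m.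
  by have := IHm i x i_gt0 Li; rewrite (minn_idPl _) // (minn_idPl (leqW _)).
rewrite (minn_idPr _) //.
(* For fixed [m], downward induction on [i] supplies the [q]-th powers of [lcs i.+1] that the
   collection formula requires. *)
have [k] := ubnP (m.+1 - i); elim: k => // k IHk in i x i_gt0 Li lt_mi *.
move=> lt_k; have [le_mi|lt_im] := leqP m.+1 i.
  by apply: lcs_leq (le_mi) _; apply: subgroupX.
have LqT y : lcs i.+1 y -> lcs m.+1 (y ^+ q) by move=> Ly; apply: (IHk i.+1) => //; lia.
have LT y : lcs (i + r).-1 y -> lcs m.+1 y by apply: lcs_leq.
have HP g u := @lcs_power_mul i r q _ g u i_gt0 (lcs_subgroup m.+1) LT LqT dvd_q' r_gt1.
have mulL g u : lcs i u -> lcs m.+1 (g ^+ q) -> lcs m.+1 (u ^+ q) ->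
    lcs m.+1 ((g * u) ^+ q).
  move=> Lu Tg Tu; apply: subgroupMl (HP g u Lu) => //.
  by apply: subgroupV => //; apply: subgroupM.
case: i => [|[|i]] // in i_gt0 Li lt_mi lt_im {IHk lt_k LqT LT} HP mulL *.
  elim: (genS x) => [y /Sq|||y _ Ly]; first exact: lcs_leq.
  - by rewrite expg1n; apply: subgroup1.
  - by move=> y z _ Ly _ Lz; apply: mulL.
  - by rewrite expVgn; apply: subgroupV.
have sub_g g : lcs i.+1 g -> lcs m (g ^+ q).
  by move=> Lg; have := IHm i.+1 g isT Lg; rewrite (minn_idPr _) //; lia.
suff [] : lcs i.+2 x /\ lcs m.+1 (x ^+ q) by [].
rewrite lcsSS in Li; elim: Li => {x} [_ [g [h [Lg ->]]]||x y _ [Lx Tx] _ [Ly Ty]|x _ [Lx Tx]].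
- split; first exact: lcs_commS.
  (* As [g * [~ g, h]] is [g ^ h], this compares [[~ g, h] ^+ q] with [[~ g ^+ q, h]], which the
     outer induction puts into [lcs m.+1]. *)
  have := HP g _ (lcs_commS h Lg); rewrite -conj_mulR -conjXg => HPg.
  have := lcs_commS h (sub_g g Lg).
  have -> : [~ g ^+ q, h] = [~ g, h] ^+ q *
      ((g ^+ q * [~ g, h] ^+ q)^-1 * (g ^+ q) ^ h).
    by rewrite invgM -[X in _ * X]mulgA mulKVg.
  exact: subgroupMr.
- by rewrite expg1n; split; apply: subgroup1.
- by split; [apply: subgroupM|apply: mulL].
- by rewrite expVgn; split; apply: subgroupV.
Qed.

End LowerCentral.

(** * The nilpotency class of nu G *)

Section Morphisms.
Variables (G H : groupType) (c : G -> H).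
Hypothesis cM : {morph c : x y / x * y}.

Lemma morph1V : c 1 = 1 /\ (forall x, c x^-1 = (c x)^-1).
Proof.
have c1 : c 1 = 1 by apply: (mulgI (c 1)); rewrite -cM !mulg1.
by split=> // x; apply: (mulgI (c x)); rewrite -cM !mulgV.
Qed.

Lemma morphJ x y : c (x ^ y) = c x ^ c y.
Proof. by have [_ cV] := morph1V; rewrite /conjg !cM cV. Qed.

Lemma morphC x y : c [~ x, y] = [~ c x, c y].
Proof. by have [_ cV] := morph1V; rewrite /commg cM cV morphJ. Qed.

Lemma morph_expg m x : c (x ^+ m) = c x ^+ m.
Proof.
by have [c1 _] := morph1V; elim: m => [|m IHm]; rewrite ?expg0 // !expgS cM IHm.
Qed.

Lemma lcs_morph k x : lcs k x -> lcs k (c x).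
Proof.
have [c1 cV] := morph1V; elim: k x => [|[|k] IHk] x //.
rewrite lcsSS; elim=> {x} [_ [y [z [Ly ->]]]||x y _ Lx _ Ly|x _ Lx].
- by rewrite morphC; apply/lcs_commS/IHk.
- by rewrite c1; apply: gen_one.
- by rewrite cM; apply: gen_mul.
- by rewrite cV; apply: gen_inv.
Qed.

End Morphisms.

(** * Commutators between two copies of a group *)

Section CommutingCopies.
Variables (G H : groupType) (a b : G -> H).
Hypotheses (aM : {morph a : x y / x * y}) (bM : {morph b : x y / x * y}).
Hypothesis aconj : forall g1 g2 g3,
  [~ a g1, b g2] ^ a g3 = [~ a (g1 ^ g3), b (g2 ^ g3)].
Hypothesis bconj : forall g1 g2 g3,
  [~ a g1, b g2] ^ b g3 = [~ a (g1 ^ g3), b (g2 ^ g3)].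
Implicit Types (g h x y : G).

Definition cross_comm n : H -> Prop :=
  gen (fun z => exists x h, lcs n x /\ z = [~ a x, b h]).

(** Both families of relations conjugate [[~ a x, b h]] to the same element. *)
Lemma cross_conj t g : cross_comm 1 t -> t ^ a g = t ^ b g.
Proof.
elim=> {t} [_ [x [h [_ ->]]]||x y _ IHx _ IHy|x _ IHx].
- by rewrite aconj bconj.
- by rewrite !conj1g.
- by rewrite !conjMg IHx IHy.
- by rewrite !conjVg IHx.
Qed.

Lemma cross_comm_conj n t g : cross_comm n t -> cross_comm n (t ^ a g).
Proof.
elim=> {t} [_ [x [h [Lx ->]]]||x y _ IHx _ IHy|x _ IHx].
- by rewrite aconj; apply: gen_incl; exists (x ^ g), (h ^ g); split=> //; apply: lcs_normal.
- by rewrite conj1g; apply: gen_one.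
- by rewrite conjMg; apply: gen_mul.
- by rewrite conjVg; apply: gen_inv.
Qed.

Lemma cross_comm_incl n x h : lcs n x -> cross_comm n [~ a x, b h].
Proof. by move=> Lx; apply: gen_incl; exists x, h. Qed.

Lemma cross_comm_anti n t : cross_comm n.+1 t -> cross_comm n t.
Proof.
apply: gen_sub; first exact: gen_subgroup.
by move=> _ [x [h [Lx ->]]]; apply: cross_comm_incl; apply: lcs_anti.
Qed.

Lemma cross_comm1 n t : cross_comm n t -> cross_comm 1 t.
Proof.
apply: gen_sub; first exact: gen_subgroup.
by move=> _ [x [h [Lx ->]]]; apply: cross_comm_incl.
Qed.

(** Write [[~ g1, g2]] as [g1^-1 * g1 ^ g2] and expand: the two sides differ only in conjugating
    elements of [cross_comm 1] by [a g2] or by [b g2]. *)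
Lemma cross_commR g1 g2 h : [~ a [~ g1, g2], b h] = [~ [~ a g1, b g2], b h].
Proof.
have [_ aV] := morph1V aM; have [_ bV] := morph1V bM.
have -> : a [~ g1, g2] = (a g1)^-1 * a (g1 ^ g2) by rewrite /commg aM aV.
rewrite [[~ a g1, b g2]]commgEl !(commMgJ (a g1)^-1); congr (_ * _).
  rewrite (morphJ aM).
  have Tt : cross_comm 1 [~ (a g1)^-1, b h] by rewrite -aV; apply: cross_comm_incl.
  set t := [~ _, _] in Tt *.
  rewrite (conjgE (a g1) (a g2)) (conjgE (a g1) (b g2)) !conjgM -aV -bV -(cross_conj _ Tt).
  by apply: cross_conj; do 2!apply: cross_comm_conj.
rewrite -[in b h](conjgKV g2 h) -aconj cross_conj; last exact: cross_comm_incl.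
by rewrite conjRg -(morphJ bM).
Qed.

End CommutingCopies.

Section NilpotencyClass.
Variables (G H : groupType) (a b : G -> H).
Hypotheses (aM : {morph a : x y / x * y}) (bM : {morph b : x y / x * y}).
Hypothesis aconj : forall g1 g2 g3,
  [~ a g1, b g2] ^ a g3 = [~ a (g1 ^ g3), b (g2 ^ g3)].
Hypothesis bconj : forall g1 g2 g3,
  [~ a g1, b g2] ^ b g3 = [~ a (g1 ^ g3), b (g2 ^ g3)].
Hypothesis genH : forall z, gen (fun z => exists g, z = a g \/ z = b g) z.

Let T := cross_comm a b.

(** Stability under [y] and [y^-1] is proved jointly, which settles inverses of words. *)
Lemma generated_normal (A : H -> Prop) :
  (forall z g, A z -> A (z ^ a g)) -> (forall z g, A z -> A (z ^ b g)) ->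
  is_normal A.
Proof.
move=> Aa Ab x y Ax; have [_ aV] := morph1V aM; have [_ bV] := morph1V bM.
suff [] : (forall z, A z -> A (z ^ y)) /\ (forall z, A z -> A (z ^ y^-1)).
  by move=> Ay _; apply: Ay.
have Gy := genH y; elim: y / Gy => [_ [g [->|->]]||u v _ [Au AuV] _ [Av AvV]|u _ [Au AuV]].
- by split=> z; rewrite -?aV; apply: Aa.
- by split=> z; rewrite -?bV; apply: Ab.
- by split=> z; rewrite ?invg1 conjg1.
- split=> z Az; first by rewrite conjgM; apply/Av/Au.
  by rewrite invgM conjgM; apply/AuV/AvV.
- by split=> // z Az; rewrite invgK; apply: Au.
Qed.

Lemma cross_comm_normal n : is_normal (T n).
Proof.
apply: generated_normal => z g Tz; first exact: cross_comm_conj.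
by rewrite -(cross_conj aconj bconj _ (cross_comm1 Tz)); apply: cross_comm_conj.
Qed.

(** On generators, [cross_commR] turns [[~ [~ a x, b h], b g]] into [[~ a [~ x, h], b g]], and [a g]
    acts as [b g] does. *)
Lemma cross_comm_commS n t z : T n t -> T n.+1 [~ t, z].
Proof.
have gT : is_subgroup (T n.+1) by apply: gen_subgroup.
move=> Tt; apply: gen_comm Tt (genH z) => //; first exact: cross_comm_normal.
move=> u v [x [h [Lx ->]]] [g].
have TR : T n.+1 [~ [~ a x, b h], b g].
  by rewrite -(cross_commR aM bM aconj bconj); apply/cross_comm_incl/lcs_commS.
case=> ->; last by [].
by rewrite commgEl (cross_conj aconj bconj) //; apply: cross_comm_incl.
Qed.

(** The relations are symmetric in [a] and [b] up to inversion, so [cross_commR] also holds with the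
    copies exchanged; then induct on [n]. *)
Lemma cross_comm_sym n x g : lcs n x -> T n [~ b x, a g].
Proof.
have gT m : is_subgroup (T m) by apply: gen_subgroup.
have sym m y h : lcs m h -> T m [~ b y, a h].
  by move=> Lh; rewrite -invgR; apply: subgroupV => //; apply: cross_comm_incl.
have symR g1 g2 h : [~ b [~ g1, g2], a h] = [~ [~ b g1, a g2], a h].
  apply: cross_commR => // {g1 g2 h} g1 g2 g3; rewrite -invgR conjVg ?aconj ?bconj.
    by rewrite invgR.
  by rewrite invgR.
case: n => [|n]; first by move=> _; apply: sym.
elim: n x g => [|n IHn] x g; first by move=> _; apply: sym.
rewrite lcsSS => Lx; have [b1 bV] := morph1V bM.
elim: Lx => {x} [_ [y [h [Ly ->]]]||x y _ Tx _ Ty|x _ Tx].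
- by rewrite symR; apply: cross_comm_commS; apply: IHn.
- by rewrite b1 comm1g; apply: subgroup1.
- by rewrite bM commMgJ; apply: subgroupM => //; apply: cross_comm_normal.
- rewrite bV; suff -> : [~ (b x)^-1, a g] = ([~ b x, a g] ^ (b x)^-1)^-1.
    by apply: subgroupV => //; apply: cross_comm_normal.
  by group_norm.
Qed.

(* [lcs n] of [H] is generated by the two copies of [lcs n] of [G] and by
   [[lcs n.-1 G, G^phi]]. *)
Let E n := gen (fun z => [\/ exists2 x, lcs n x & z = a x,
                            exists2 x, lcs n x & z = b x | T n.-1 z]).

Let E_a n x : lcs n x -> E n (a x).
Proof. by move=> Lx; apply: gen_incl; apply: Or31; exists x. Qed.

Let E_b n x : lcs n x -> E n (b x).
Proof. by move=> Lx; apply: gen_incl; apply: Or32; exists x. Qed.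

Let E_T n z : T n.-1 z -> E n z.
Proof. by move=> Tz; apply: gen_incl; apply: Or33. Qed.

Let E_subgroup n : is_subgroup (E n). Proof. exact: gen_subgroup. Qed.

Let T_predn n z : T n z -> T n.-1 z.
Proof. by case: n => // n; apply: cross_comm_anti. Qed.

Let E_normal n : is_normal (E n).
Proof.
apply: generated_normal => z g; elim=> {z} [z||z w _ Ez _ Ew|z _ Ez];
  rewrite ?conj1g ?conjMg ?conjVg;
  try solve [exact: subgroup1 | exact: subgroupM | exact: subgroupV].
  case=> [[x Lx ->]|[x Lx ->]|Tz].
  - by rewrite -morphJ //; apply/E_a/lcs_normal.
  - rewrite conj_mulR; apply: subgroupM => //; first exact: E_b.
    by apply/E_T/T_predn/cross_comm_sym.
  - by apply/E_T/cross_comm_normal.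
case=> [[x Lx ->]|[x Lx ->]|Tz].
- rewrite conj_mulR; apply: subgroupM => //; first exact: E_a.
  by apply/E_T/T_predn/cross_comm_incl.
- by rewrite -morphJ //; apply/E_b/lcs_normal.
- by apply/E_T/cross_comm_normal.
Qed.

Lemma lcs_cross n z : lcs n z -> E n z.
Proof.
have E01 m : m < 2 -> forall z, E m z.
  move=> lt_m2 {}z; apply: gen_sub (genH z) => // _ [g [->|->]].
    by apply: E_a; case: m lt_m2 => [|[]].
  by apply: E_b; case: m lt_m2 => [|[]].
elim: n z => [|[|n] IHn] z; try by move=> _; apply: E01.
rewrite lcsSS; apply: gen_sub => // {z} _ [x [y [/IHn Ex ->]]].
apply: gen_comm Ex (genH y) => // {x y} x _ Ex [g [->|->]].
  case: Ex => [[x1 L1 ->]|[x1 L1 ->]|Tx].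
  - by rewrite -morphC //; apply/E_a/lcs_commS.
  - by apply/E_T/cross_comm_sym.
  - by apply: E_T; apply: cross_comm_commS.
case: Ex => [[x1 L1 ->]|[x1 L1 ->]|Tx].
- by apply/E_T/cross_comm_incl.
- by rewrite -morphC //; apply/E_b/lcs_commS.
- by apply: E_T; apply: cross_comm_commS.
Qed.

Lemma cross_lcs_trivial n : (forall x : G, lcs n.+1 x -> x = 1) ->
  forall z : H, lcs n.+2 z -> z = 1.
Proof.
move=> L1 z; have [a1 _] := morph1V aM; have [b1 _] := morph1V bM.
have triv : is_subgroup (fun z : H => z = 1).
  by split=> [|x y -> ->|x ->]; rewrite ?mulg1 ?invg1.
move/lcs_cross; apply: (gen_sub triv) => {}z.
move=> [[x /lcs_anti/L1-> ->] // | [x /lcs_anti/L1-> ->] //|].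
apply: (gen_sub triv) => _ [x [h [/L1-> ->]]].
by rewrite a1 comm1g.
Qed.

End NilpotencyClass.

Section NuGenerators.
Variable G : groupType.

Definition nu_l (g : G) : nu G := pclass (@nu_rel G) (nu_in g).
Definition nu_r (g : G) : nu G := pclass (@nu_rel G) (nu_phi g).

Lemma nu_lM : {morph nu_l : x y / x * y}.
Proof. by move=> x y; rewrite /nu_l -pclassM; apply/pclassP/GC_sym/GC_rel/NuMul. Qed.

Lemma nu_rM : {morph nu_r : x y / x * y}.
Proof. by move=> x y; rewrite /nu_r -pclassM; apply/pclassP/GC_sym/GC_rel/NuMulPhi. Qed.

Lemma nu_commE (g1 g2 : G) :
  [~ nu_l g1, nu_r g2] = pclass (@nu_rel G) [~ nu_in g1, nu_phi g2].
Proof. by rewrite /commg /conjg !(pclassM, pclassV). Qed.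

Lemma pclassJ X (R : gterm X -> gterm X -> Prop) (s t : gterm X) :
  pclass R (s ^ t) = pclass R s ^ pclass R t.
Proof. by rewrite /conjg !(pclassM, pclassV). Qed.

Lemma nu_lconj g1 g2 g3 :
  [~ nu_l g1, nu_r g2] ^ nu_l g3 = [~ nu_l (g1 ^ g3), nu_r (g2 ^ g3)].
Proof.
by rewrite !nu_commE -pclassJ; apply/pclassP/GC_rel/NuConj.
Qed.

Lemma nu_rconj g1 g2 g3 :
  [~ nu_l g1, nu_r g2] ^ nu_r g3 = [~ nu_l (g1 ^ g3), nu_r (g2 ^ g3)].
Proof.
by rewrite !nu_commE -pclassJ; apply/pclassP/GC_sym/GC_rel/NuConjPhi.
Qed.

Lemma nu_gen (z : nu G) : gen (fun z => exists g, z = nu_l g \/ z = nu_r g) z.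
Proof.
rewrite -(preprK z); elim: (prepr z) => {z} [[g|g]||s IHs|s IHs t IHt].
- by apply: gen_incl; exists g; left.
- by apply: gen_incl; exists g; right.
- exact: gen_one.
- by rewrite pclassV; apply: gen_inv.
- by rewrite pclassM; apply: gen_mul.
Qed.

Lemma nu_lcs_trivial n : (forall x : G, lcs n.+1 x -> x = 1) ->
  forall z : nu G, lcs n.+2 z -> z = 1.
Proof.
exact: cross_lcs_trivial nu_lM nu_rM nu_lconj nu_rconj nu_gen n.
Qed.

End NuGenerators.

Section PowerMulDeep.
Variable K : groupType.

(** With both factors in [lcs i], commutators of weight [j] lie in [lcs (i * j)]. *)
Lemma lcs_power_mul_deep i r q (T : K -> Prop) x y : 0 < i ->
    is_subgroup T -> (forall z, lcs (i * r) z -> T z) ->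
    (forall z, lcs (i * 2) z -> T (z ^+ q)) ->
    (forall j, 1 < j < r -> q %| 'C(q, j)) -> 0 < r ->
  lcs i x -> lcs i y -> T ((x ^+ q * y ^+ q)^-1 * (x * y) ^+ q).
Proof.
move=> i_gt0 gT LT LqT dvd_q r_gt0 Lx Ly.
apply: (@power_mul K r (fun d => lcs (i * maxn d 1))) => //.
- by move=> d; apply: lcs_subgroup.
- by move=> d z; apply: lcs_leq; rewrite leq_pmul2l // geq_max !leq_max leqnSn leqnn orbT.
- move=> d e z t Lz Lt; have [d0|d_gt0] := posnP d.
    by rewrite d0 add0n; apply: comm_normr => //; [apply: lcs_subgroup|apply: lcs_normal].
  have [e0|e_gt0] := posnP e.
    by rewrite e0 addn0; apply: comm_norml => //; [apply: lcs_subgroup|apply: lcs_normal].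
  apply: lcs_leq (lcs_comm Lz Lt).
  by rewrite -mulnDr leq_pmul2l // !(maxn_idPl _) // addn_gt0 d_gt0.
- by rewrite (maxn_idPl r_gt0).
- by rewrite maxnn muln1.
- by rewrite maxnn muln1.
Qed.

End PowerMulDeep.

(** * Finite p-groups of maximal class *)

Section FiniteLowerCentral.
Variable gT : finGroupType.
Implicit Types (x y : gT) (A : {set gT}).

Lemma mem_genP A x : reflect (gen (fun z => z \in A) x) (x \in <<A>>).
Proof.
apply: (iffP idP) => [|]; last first.
  elim=> {x} [x Ax||x y _ Ax _ Ay|x _ Ax]; first exact: mem_gen.
  - exact: group1.
  - exact: groupM.
  - by rewrite groupV.
have gB : group_set [set x | `[< gen (fun z => z \in A) x >]].
  apply/group_setP; split=> [|y z]; rewrite ?inE; first exact/asboolP/gen_one.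
  by move=> /asboolP Ay /asboolP Az; apply/asboolP/gen_mul.
have /subsetP sAB : <<A>> \subset group gB.
  by rewrite gen_subG; apply/subsetP=> y Ay; rewrite inE; apply/asboolP/gen_incl.
by move/sAB; rewrite inE => /asboolP.
Qed.

Lemma lcsP n x : reflect (lcs n x) (x \in 'L_n([set: gT])).
Proof.
elim: n x => [|[|n] IHn] x; try by rewrite inE; constructor.
rewrite lcnSn lcsSS; apply: (iffP (mem_genP _ _)) => Lx.
  apply: gen_sub Lx => [|z /imset2P[y t Ly _ ->]]; first exact: gen_subgroup.
  by apply: gen_incl; exists y, t; split=> //; apply/IHn.
apply: gen_sub Lx => [|z [y [t [/IHn Ly ->]]]]; first exact: gen_subgroup.
by apply: gen_incl; apply: imset2_f; rewrite ?inE.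
Qed.

End FiniteLowerCentral.

(** * Commutation with a prime power on an abelian subgroup *)

Section IteratedCommutators.
Import GRing.Theory.

(** Binomial theorem for [phi = 1 + D]. *)
Lemma iter_additive (V : zmodType) (phi : V -> V) (n : nat) (v : V) :
    {morph phi : x y / (x + y)%R} ->
  iter n phi v = (\sum_(j < n.+1) iter j (fun w => phi w - w) v *+ 'C(n, j))%R.
Proof.
move=> phiD; have phi0 : phi 0%R = 0%R by apply: (addrI (phi 0%R)); rewrite -phiD !addr0.
have phiMn m w : (phi (w *+ m) = phi w *+ m)%R.
  by elim: m => [|m IHm]; rewrite ?mulr0n // !mulrS phiD IHm.
pose D w := (phi w - w)%R.
elim: n => [|n IHn]; first by rewrite big_ord_recl big_ord0 /= bin0 mulr1n addr0.
rewrite iterS IHn (big_morph phi phiD phi0) -/D.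
under eq_bigr => j _ do rewrite phiMn -(subrK (iter j D v) (phi _)) -/(D _) -iterS mulrnDl.
rewrite big_split /= [RHS]big_ord_recl /= bin0.
under [in RHS]eq_bigr => j _ do rewrite /bump /= add1n binS mulrnDr addrC.
rewrite big_split /= -[in RHS]addrCA; congr (_ + _)%R.
rewrite [LHS]big_ord_recl /= bin0; congr (_ + _)%R.
by rewrite [RHS]big_ord_recr /= bin_small // mulr0n addr0.
Qed.

(* On [A], [s] acts as [1 + D] with [D = [_, s]], and [(1 + D) ^ p = 1 + D ^ p]
   up to terms killed by [p]. *)
Lemma comm_prime_power (gT : finGroupType) (A : {group gT}) (p : nat) (a s : gT) :
    prime p -> abelian A -> s \in 'N(A) -> a \in A ->
    (forall j, 0 < j -> iter j (fun w => [~ w, s]) a ^+ p = 1) ->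
  [~ a, s ^+ p] = iter p (fun w => [~ w, s]) a.
Proof.
move=> p_pr abA Ns Aa ap1.
pose phi (u : FiniteModule.fmod_of abA) := FiniteModule.actr u s.
pose D w := [~ w, s].
have AD j : iter j D a \in A.
  by elim: j => //= j IHj; rewrite /D commgEl groupM ?groupV ?memJ_norm.
have phiE x : x \in A -> phi (FiniteModule.fmod abA x) = FiniteModule.fmod abA (x ^ s).
  by move=> Ax; rewrite FiniteModule.fmodJ.
have DE j : iter j (fun w => phi w - w)%R (FiniteModule.fmod abA a) =
    FiniteModule.fmod abA (iter j D a).
  elim: j => //= j ->; have Aj := AD j; rewrite phiE // -/(D _) /D commgEl.
  by rewrite [in RHS]FiniteModule.fmodM ?groupV ?memJ_norm // FiniteModule.fmodV addrC.
have phiX n : iter n phi (FiniteModule.fmod abA a) = FiniteModule.fmod abA (a ^ (s ^+ n)).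
  elim: n => [|n IHn]; first by rewrite expg0 conjg1.
  by rewrite iterS IHn phiE ?memJ_norm ?groupX // -conjgM expgSr.
case: p p_pr ap1 => // q p_pr ap1.
have := iter_additive q.+1 (FiniteModule.fmod abA a) (FiniteModule.actAr s).
rewrite -/phi phiX (eq_bigr (fun j : 'I_q.+2 =>
  FiniteModule.fmod abA (iter j D a ^+ 'C(q.+1, j)))) => [|j _]; last first.
  by rewrite FiniteModule.fmodX // -DE.
(* Only the terms for [j = 0] and [j = p] survive: otherwise [p] divides the binomial coefficient
   and kills the iterated commutator. *)
rewrite big_ord_recl big_ord_recr big1 => [|j _]; last first.
  have /dvdnP[m ->] : q.+1 %| 'C(q.+1, lift ord0 (widen_ord (leqnSn q) j)).
    by apply: prime_dvd_bin => //=; rewrite /bump add1n ltnS.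
  by rewrite mulnC expgnA ap1 // expg1n FiniteModule.fmod1.
rewrite Monoid.mul1m /bump /= /bump bin0 add1n binn !expg1 -FiniteModule.fmodM ?(AD q.+1) //.
move/FiniteModule.congr_fmod; rewrite !FiniteModule.fmodK ?memJ_norm ?groupX //.
  by move=> E; rewrite commgEl E mulKg.
by rewrite groupM ?(AD q.+1).
Qed.

End IteratedCommutators.

(** * Lower central factors and two-step centralizers *)

Section MaximalClassGroups.
Variables (p : nat) (gT : finGroupType).
Hypotheses (p_pr : prime p) (maxG : maximal_class p [set: gT]%G).
Implicit Types (x y s a : gT).

Local Notation G := [set: gT].
Local Notation L k := ('L_k(G)).
Let n := logn p #|G|.

Let pG : p.-group G. Proof. by case/andP: maxG. Qed.
Let nilG : nilpotent G. Proof. exact: pgroup_nil pG. Qed.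

Let class_succ : (nil_class G).+1 = n.
Proof. by case/andP: maxG => _ /eqP; rewrite /coclass /= -/n; lia. Qed.

Let n_gt1 : 1 < n.
Proof.
rewrite -class_succ ltnS lt0n nil_class0; apply/eqP => G1.
by have := class_succ; rewrite /n G1 cards1 logn1.
Qed.

Lemma lcn_trivial x : x \in L n -> x = 1.
Proof.
rewrite -class_succ; have /lcn_nil_classP -> // := leqnn (nil_class G).
by move/set1P.
Qed.

Let lL k := logn p #|L k|.

Let card_L k : #|L k| = (p ^ lL k)%N.
Proof. by apply: card_pgroup; apply: pgroupS pG; apply: subsetT. Qed.

Let lL_ltS k : 0 < k -> k < n -> lL k.+1 < lL k.
Proof.
move=> k_gt0 lt_kn; apply: properG_ltn_log.
  by apply: pgroupS pG; apply: subsetT.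
case: k k_gt0 lt_kn => // k _ lt_kn; rewrite /= lcnSn.
apply: (nil_comm_properl nilG) => //; first exact: lcn_sub.
  apply/eqP => /(lcn_nil_classP _ nilG).
  by apply/negP; rewrite -ltnNge -ltnS class_succ.
by rewrite subsetI subxx lcn_norm.
Qed.

Let noncyclic : 2 < n -> ~~ cyclic (G / L 2).
Proof.
move=> n_gt2; apply/negP => /(cyclic_nilpotent_quo_der1_cyclic nilG).
by move/cyclic_abelian; rewrite -nil_class1 -ltnS class_succ; lia.
Qed.

Let card_quo : #|G / L 2| = (p ^ (n - lL 2))%N.
Proof.
rewrite card_quotient ?lcn_norm // -divgS ?subsetT // card_L (card_pgroup pG).
by rewrite -expnB ?prime_gt0 // dvdn_leq_log // cardSg ?subsetT.
Qed.

Let lL2 : lL 2 + 2 <= n.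
Proof.
have [n2|n_neq2] := eqVneq n 2.
  suff -> : lL 2 = 0 by rewrite n2.
  have L2 : L 2 = 1 by apply/trivgP/subsetP => x; rewrite -n2 inE => /lcn_trivial->.
  by rewrite /lL L2 cards1 logn1.
have lt21 : lL 2 < n by have := lL_ltS (ltnSn 0) n_gt1; rewrite /n /lL.
rewrite leqNgt; apply/negP => lt_n.
have n1 : n - lL 2 = 1%N by lia.
have : cyclic (G / L 2) by apply: prime_cyclic; rewrite card_quo n1 expn1.
by apply/negP/noncyclic; have := n_gt1; lia.
Qed.

(** Strict descent gives both bounds, counting down from [L 2], of index at least [p ^ 2], and up
    from [L n]. *)
Let lL_E k : 1 < k -> k <= n -> lL k = n - k.
Proof.
move=> k_gt1 le_kn; apply/eqP; rewrite eqn_leq; apply/andP; split.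
  elim: k k_gt1 le_kn => // k IHk lt1k le_kn.
  have [k1|k_neq1] := eqVneq k 1%N; first by rewrite k1; have := lL2; lia.
  have /IHk : 1 < k by lia.
  by have := @lL_ltS k; lia.
rewrite -(subKn le_kn); have: n - k <= n - 2 by lia.
elim: (n - k) => [|m IHm] le_m; first by rewrite subn0 subnn.
have := @lL_ltS (n - m.+1); have -> : (n - m.+1).+1 = n - m by lia.
have := n_gt1; lia.
Qed.

Lemma card_lcn k : 1 < k -> k <= n -> #|L k| = (p ^ (n - k))%N.
Proof. by move=> k_gt1 le_kn; rewrite card_L lL_E. Qed.

Lemma lcn_ex k : 0 < k -> k < n -> exists2 x, x \in L k & x \notin L k.+1.
Proof.
move=> k_gt0 lt_kn; apply/subsetPn; apply/negP => /subset_leq_card.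
rewrite !card_L leqNgt ltn_exp2l ?prime_gt1 //.
by rewrite lL_ltS.
Qed.

Lemma lcn_quo_cyclic k x y : 1 < k -> k < n ->
  x \in L k -> x \notin L k.+1 -> y \in L k ->
  exists j, exists2 z, z \in L k.+1 & y = x ^+ j * z.
Proof.
move=> k_gt1 lt_kn Lx nLx Ly.
have nLL : <[x]> \subset 'N(L k.+1) by apply: subset_trans (lcn_norm _ _); apply: subsetT.
have sub_L : <[x]> <*> L k.+1 \subset L k.
  by rewrite join_subG cycle_subG Lx lcn_subS.
have : y \in <[x]> <*> L k.+1.
  suff /eqP -> : <[x]> <*> L k.+1 == L k by [].
  rewrite eqEcard sub_L card_lcn ?(ltnW lt_kn) //= leqNgt; apply/negP.
  have pJ : p.-group (<[x]> <*> L k.+1) by apply: pgroupS pG; apply: subsetT.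
  rewrite (card_pgroup pJ) ltn_exp2l ?prime_gt1 // => lt_log.
  have : L k.+1 \proper <[x]> <*> L k.+1.
    apply/properP; split; first exact: joing_subr.
    by exists x => //; apply: (subsetP (joing_subl _ _)); apply: cycle_id.
  move/(properG_ltn_log pJ) => lt_J.
  have E : logn p #|L k.+1| = n - k.+1 by apply: lL_E lt_kn; apply: ltnW.
  by have := leq_ltn_trans lt_J lt_log; rewrite E subnSK // ltnn.
rewrite norm_joinEl // => /mulsgP[_ z /cycleP[j ->] Lz ->].
by exists j, z.
Qed.

Lemma lcn_comm k m x y : x \in L k -> y \in L m -> [~ x, y] \in L (k + m).
Proof. by move=> /lcsP Lx /lcsP Ly; apply/lcsP/lcs_comm. Qed.

Lemma lcn_commS k x y : x \in L k -> [~ x, y] \in L k.+1.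
Proof. by move=> /lcsP Lx; apply/lcsP/lcs_commS. Qed.

Lemma lcnJ k x y : x \in L k -> x ^ y \in L k.
Proof. by move=> /lcsP Lx; apply/lcsP/lcs_normal. Qed.

(* The two-step centralizer [C_G(L k / L (k + 2))]. *)
Definition centralizer2 k := [set s | [forall (a | a \in L k), [~ a, s] \in L k.+2]].

Lemma centralizer2P k s :
  reflect (forall a, a \in L k -> [~ a, s] \in L k.+2) (s \in centralizer2 k).
Proof. by rewrite inE; apply: (iffP forall_inP). Qed.

Lemma centralizer2_group_set k : group_set (centralizer2 k).
Proof.
apply/group_setP; split=> [|s t /centralizer2P Cs /centralizer2P Ct].
  by apply/centralizer2P => a _; rewrite commg1 group1.
by apply/centralizer2P => a La; rewrite commgMJ groupM ?Ct ?lcnJ ?Cs.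
Qed.
Canonical centralizer2_group k := Group (centralizer2_group_set k).

(** One element tests membership, as it generates [L k / L k.+1]. *)
Lemma centralizer2_mem k a s : 1 < k -> k < n -> a \in L k -> a \notin L k.+1 ->
  [~ a, s] \in L k.+2 -> s \in centralizer2 k.
Proof.
move=> k_gt1 lt_kn La nLa Cas; apply/centralizer2P => y Ly.
have [j [z Lz ->]] := lcn_quo_cyclic k_gt1 lt_kn La nLa Ly.
rewrite commMgJ groupM ?lcn_commS // lcnJ //.
elim: j => [|j IHj]; first by rewrite expg0 comm1g group1.
by rewrite expgS commMgJ groupM ?lcnJ.
Qed.

(** Were the centralizer all of [G], then [L k.+1] would equal [L k.+2]. *)
Lemma centralizer2_proper k : 0 < k -> k.+1 < n -> (#|centralizer2 k| * p <= #|G|)%N.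
Proof.
move=> k_gt0 lt_kn; have sCG : centralizer2 k \subset G by apply: subsetT.
have pC : p.-group (centralizer2 k) by apply: pgroupS pG.
have prC : centralizer2 k \proper G.
  rewrite properT; apply/eqP => CT.
  have /subsetP sL : L k.+1 \subset L k.+2.
    case: k k_gt0 {lt_kn sCG pC} CT => // k _ CT.
    rewrite (lcnSn k) gen_subG; apply/subsetP => _ /imset2P[a s La _ ->].
    have /centralizer2P : s \in centralizer2 k.+1 by rewrite CT inE.
    exact.
  by have [x /sL Lx /negP] := lcn_ex (ltn0Sn k) lt_kn.
have := properG_ltn_log pG prC; rewrite -/n => lt_log.
by rewrite (card_pgroup pC) (card_pgroup pG) -/n -expnSr leq_exp2l ?prime_gt1.
Qed.

Let card_bigcup_leq (ks : seq nat) (D : nat -> {set gT}) m :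
    {in ks, forall k, #|D k| * p <= m}%N ->
  (#|\bigcup_(k <- ks) D k| * p <= size ks * m)%N.
Proof.
elim: ks => [|k ks IHks] Dm; first by rewrite big_nil cards0.
rewrite big_cons /= mulSn; apply: leq_trans (leq_add (Dm k _) (IHks _)).
- by rewrite -mulnDl leq_mul2r leq_card_setU orbT.
- exact: mem_head.
- by move=> i ks_i; apply: Dm; rewrite inE ks_i orbT.
Qed.

Let notin_bigcup (ks : seq nat) (D : nat -> {set gT}) s k :
  s \notin \bigcup_(k <- ks) D k -> k \in ks -> s \notin D k.
Proof.
elim: ks => // i ks IHks; rewrite big_cons !inE negb_or => /andP[Di Dks].
by case/predU1P=> [->|/IHks->].
Qed.

(* The identity lies in every centralizer, which makes the union bound strict. *)
Lemma avoid_centralizers (ks : seq nat) :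
    {in ks, forall k, (0 < k) && (k.+1 < n)} -> size ks <= p ->
  exists s, {in ks, forall k, s \notin centralizer2 k}.
Proof.
move=> ks_ok le_p; pose D k := centralizer2 k :\ 1.
have le_pG : (p ^ 2 <= #|G|)%N.
  by rewrite (card_pgroup pG) leq_exp2l ?n_gt1 ?prime_gt1.
have Dm : {in ks, forall k, #|D k| * p <= #|G| - p}%N.
  move=> k /ks_ok/andP[k_gt0 lt_kn]; have := centralizer2_proper k_gt0 lt_kn.
  rewrite (cardsD1 1 (centralizer2 k)) group1 -/(D k) mulnDl mul1n => le_G.
  by rewrite leq_subRL // (leq_trans (leq_addr _ _) le_G).
have := card_bigcup_leq Dm; set U := \bigcup_(k <- ks) _ => le_U.
have lt_U : (#|U| + 1 < #|G|)%N.
  have p_gt1 := prime_gt1 p_pr.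
  have : (#|U| * p <= p * (#|G| - p))%N by apply: leq_trans le_U _; rewrite leq_mul2r le_p orbT.
  rewrite mulnC leq_pmul2l ?prime_gt0 //; move: le_pG; rewrite -mulnn; nia.
have [s] : exists s, s \notin 1 |: U.
  apply/existsP; rewrite -negb_forall; apply/negP => /forallP UT.
  have /setP UG : 1 |: U =i G by move=> s; rewrite UT inE.
  by move: lt_U; rewrite -UG cardsU1; case: (1 \notin U) => /=; lia.
rewrite !inE negb_or => /andP[s1 sU]; exists s => k ks_k.
by have := notin_bigcup sU ks_k; rewrite !inE s1.
Qed.

(** The centralizers cover at most a fraction [(p - 2) / p] of [G], and a proper subgroup at most
    [1 / p]. *)
Lemma avoid_generates (ks : seq nat) :
    {in ks, forall k, (0 < k) && (k.+1 < n)} -> size ks + 2 <= p ->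
  <<[set s | [forall k : 'I_n, (val k \in ks) ==> (s \notin centralizer2 k)]]>> = G.
Proof.
move=> ks_ok le_p; set S := [set _ | _].
have Cm : {in ks, forall k, #|centralizer2 k| * p <= #|G|}%N.
  by move=> k /ks_ok/andP[k_gt0 lt_kn]; apply: centralizer2_proper.
have := card_bigcup_leq Cm; set U := \bigcup_(k <- ks) _ => le_U.
have sUS : ~: U \subset <<S>>.
  apply/subsetP => s; rewrite inE => sU; apply/mem_gen; rewrite inE.
  by apply/forallP => k; apply/implyP; apply: notin_bigcup sU.
apply/eqP; rewrite -subTset -[_ \subset _]negbK; apply/negP => nGS.
have pS : <<S>> \proper G by rewrite properE subsetT.
have p_gt1 := prime_gt1 p_pr.
have := properG_ltn_log pG pS; rewrite -/n => lt_log.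
have le_S : (#|~: U| * p <= #|G|)%N.
  apply: leq_trans (_ : (#|<<S>>| * p <= #|G|)%N).
    by rewrite leq_mul2r subset_leq_card ?orbT.
  rewrite (card_pgroup (pgroupS (subsetT <<S>>) pG)) (card_pgroup pG) -/n.
  by rewrite -expnSr leq_exp2l.
have : (#|G| * p <= (size ks).+1 * #|G|)%N.
  have cG : #|G| = (#|U| + #|~: U|)%N by rewrite cardsT cardsC.
  by rewrite {1}cG mulnDl mulSn addnC leq_add.
rewrite mulnC leq_pmul2r ?cardG_gt0 //; lia.
Qed.


Let bin_dvd e j : 0 < j < p -> p ^ e %| 'C(p ^ e, j).
Proof.
case: j => // j /= lt_jp; have p_gt0 := prime_gt0 p_pr.
have co_p : coprime (p ^ e) j.+1.
  by rewrite coprime_sym coprimeXr // coprime_sym prime_coprime // gtnNdvd.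
have : p ^ e %| j.+1 * 'C(p ^ e, j.+1).
  rewrite -[X in 'C(X, _)]prednK ?expn_gt0 ?p_gt0 // -mul_bin_diag.
  by rewrite prednK ?expn_gt0 ?p_gt0 // dvdn_mulr.
by rewrite Gauss_dvdr.
Qed.

Let prime_bin_dvd j : 1 < j < p -> p %| 'C(p, j).
Proof. by move=> jp; apply: prime_dvd_bin => //; lia. Qed.

(** * Powers in groups of order greater than [p ^ p] *)

Section LargeOrder.
Hypothesis lt_pn : p < n.

(** [G / L 2] has order [p ^ 2] and is not cyclic. *)
Let power_lcn2 s : s ^+ p \in L 2.
Proof.
have n_gt2 : 2 < n by apply: leq_ltn_trans lt_pn; apply: prime_gt1.
have Ns x : x \in 'N(L 2) by apply: (subsetP (lcn_norm _ _)).
apply: coset_idr => //; rewrite morphX //.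
have Qs : coset (L 2) s \in G / L 2 by apply: mem_quotient.
have := order_dvdG Qs; rewrite card_quo lL_E; [|by []|exact: n_gt1].
rewrite (subKn n_gt1) => /(dvdn_pfactor _ _ p_pr)[m le_m2 om].
apply/eqP; rewrite -order_dvdn om.
case: m le_m2 om => [|[|[|m]]] // _ om.
have /negP[] := noncyclic n_gt2; apply/cyclicP; exists (coset (L 2) s).
apply/eqP; rewrite eq_sym eqEcard cycle_subG Qs -[#|<[_]>|]/(#[_]) om card_quo.
by rewrite andTb lL_E // (subKn n_gt1).
Qed.

(** [s ^+ p] commutes with [s]; outside [L k.+1] it would put [s] into the centralizer. *)
Let power_lcn_commute k s : 1 < k -> k < n -> s \notin centralizer2 k ->
  s ^+ p \in L k -> s ^+ p \in L k.+1.
Proof.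
move=> k_gt1 lt_kn nCs Lk; apply: contraR nCs => nLk.
apply: (centralizer2_mem k_gt1 lt_kn Lk nLk).
have /eqP -> : [~ s ^+ p, s] == 1; last exact: group1.
by apply/commgP/commute_sym/commuteX/commute_refl.
Qed.

Lemma lcn_power i x : 0 < i -> x \in L i -> x ^+ p \in L (i + p).-1.
Proof.
have p_gt1 := prime_gt1 p_pr.
(* Avoiding the indices 2 to [p - 1] lifts [s ^+ p] from [L 2] to [L p]. *)
pose ks := iota 2 (p - 2).
have ks_ok : {in ks, forall k, (0 < k) && (k.+1 < n)}.
  by move=> k; rewrite mem_iota => /andP[]; have := lt_pn; lia.
have le_ks : size ks + 2 <= p by rewrite size_iota subnK.
have genG := avoid_generates ks_ok le_ks.
move=> i_gt0 /lcsP Lx; apply/lcsP.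
pose S s := {in ks, forall k, s \notin centralizer2 k}.
move: i x i_gt0 Lx; apply: (@lcs_power _ p p S) => //.
- by move=> j jp; apply: prime_dvd_bin.
- move=> x; have := in_setT x; rewrite -genG => /mem_genP.
  apply: gen_sub => [|y]; first exact: gen_subgroup.
  rewrite inE => /forallP Sy; apply: gen_incl => k ks_k.
  have lt_kn : k < n by have /andP[_ /ltnW] := ks_ok k ks_k.
  by have /implyP := Sy (Ordinal lt_kn); apply.
move=> s Ss; apply/lcsP.
suff : forall m, m <= p - 2 -> s ^+ p \in L m.+2.
  by move/(_ _ (leqnn _)); rewrite -addn2 subnK.
elim=> [|m IHm] le_m; first exact: power_lcn2.
apply: power_lcn_commute => //; first by have := lt_pn; lia.
  by apply: Ss; rewrite mem_iota; lia.
by apply: IHm; apply: ltnW.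
Qed.

Let L_sub m k x : m <= k -> x \in L k -> x \in L m.
Proof. by move=> le_mk; apply/subsetP/lcn_sub_leq. Qed.

Let lcn_power_deep i m x : 0 < i -> m <= (i + p).-1 -> x \in L i -> x ^+ p \in L m.
Proof. by move=> i_gt0 le_m Lx; apply: (L_sub le_m); apply: lcn_power. Qed.

Lemma centralizer2_power i s : p < i -> i + p <= n ->
    (forall k, p <= k -> k < (i + p).-1 -> s \notin centralizer2 k) ->
  forall a, a \in L i -> a \notin L i.+1 -> a ^+ p \notin L (i + p).
Proof.
move=> lt_pi le_ipn nCs a La nLa; apply/negP => Lap.
have p_gt1 := prime_gt1 p_pr.
have lt_in : i < n by nat_lia.
have i_gt1 : 1 < i by nat_lia.
(* The assumption on [a] spreads to [L i], cyclic modulo [L i.+1]; the error term lies in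
   [L (i * p)], hence in [L (i + p)]. *)
have Lp x : x \in L i -> x ^+ p \in L (i + p).
  move=> Lx; have [j [z Lz ->]] := lcn_quo_cyclic i_gt1 lt_in La nLa Lx.
  have Laj : a ^+ j \in L i by rewrite groupX.
  have Lz' : z \in L i by apply: L_sub Lz.
  have /lcsP : lcs (i + p) (((a ^+ j) ^+ p * z ^+ p)^-1 * (a ^+ j * z) ^+ p).
    apply: (@lcs_power_mul_deep _ i p p) => //; try exact/lcsP.
    - exact: ltnW.
    - exact: lcs_subgroup.
    - by move=> t; apply: lcs_leq; apply: addn_leq_muln.
    - by move=> t /lcsP Lt; apply/lcsP/(lcn_power_deep _ _ Lt); nat_lia.
    - exact: ltnW.
  rewrite groupMl // groupV groupM //.
    by rewrite -expgnA mulnC expgnA groupX.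
  by apply: lcn_power_deep Lz; nat_lia.
(* This extra degree is what places [[~ b, s ^+ p]] in [L (i + p)]. *)
have s_p : s ^+ p \in L p.+1.
  apply: power_lcn_commute => //; first by apply: nCs; nat_lia.
  by apply: (@lcn_power_deep 1) => //; apply: in_setT.
have i1_gt0 : 0 < i.-1 by nat_lia.
have lt_i1n : i.-1 < n by nat_lia.
have [b Lb nLb] := lcn_ex i1_gt0 lt_i1n.
pose w j := iter j (fun x => [~ x, s]) b.
have Lw j : w j \in L (i.-1 + j).
  by elim: j => [|j IHj]; rewrite ?addn0 // addnS; apply: lcn_commS.
have nLw j : j <= p -> w j \notin L (i.-1 + j).+1.
  elim: j => [|j IHj] lt_jp; first by rewrite addn0.
  have {}IHj := IHj (ltnW lt_jp).
  have := nCs (i.-1 + j); rewrite addnS => nC.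
  apply: contra (nC _ _); [|nat_lia|nat_lia].
  by apply: (@centralizer2_mem _ (w j)) => //; nat_lia.
(* [L i.-1] is cyclic modulo [L i], and [[L i.-1, L i]] is deep enough because [p < i]. *)
have cLL x y : x \in L i.-1 -> y \in L i.-1 -> [~ x, y] \in L (i + p).
  move=> Lx Ly; have i1_gt1 : 1 < i.-1 by nat_lia.
  have E : i.-1.+1 = i by nat_lia.
  have le_ip : i + p <= i + i.-1 by nat_lia.
  have [j [c Lc ->]] := lcn_quo_cyclic i1_gt1 lt_i1n Lb nLb Lx.
  have [k [d Ld ->]] := lcn_quo_cyclic i1_gt1 lt_i1n Lb nLb Ly.
  rewrite E in Lc Ld.
  rewrite commMgJ groupM //; last first.
    apply: (L_sub le_ip); apply: lcn_comm => //.
    by rewrite groupM ?groupX // (L_sub _ Ld) // -E.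
  apply: lcnJ; rewrite commgMJ groupM //.
    by apply: (L_sub le_ip); rewrite addnC lcn_comm ?groupX.
  apply: lcnJ; have /eqP -> : [~ b ^+ j, b ^+ k] == 1.
    by apply/commgP/commuteX2.
  exact: group1.
pose A := (L i.-1 / L (i + p))%G.
have abA : abelian A.
  apply: quotient_cents2r; rewrite gen_subG.
  by apply/subsetP => _ /imset2P[x y Lx Ly ->]; apply: cLL.
have Ns x : x \in 'N(L (i + p)) by apply: (subsetP (lcn_norm _ _)).
pose c x := coset (L (i + p)) x.
have cR x y : c [~ x, y] = [~ c x, c y] by rewrite /c morphR.
have wE j : c (w j) = iter j (fun x : coset_of (L (i + p)) => [~ x, c s]) (c b).
  by elim: j => //= j <-; rewrite cR.
have nA : c s \in 'N(A).
  by apply: (subsetP (quotient_norms _ (lcn_norm _ _))); apply: mem_quotient.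
have Ab : c b \in A by apply: mem_quotient.
have := comm_prime_power p_pr abA nA Ab; rewrite -wE => E.
have /negP[] := nLw p (leqnn p).
have -> : (i.-1 + p).+1 = i + p by nat_lia.
apply: coset_idr => //; rewrite -/(c _) -E => [|j j_gt0]; last first.
  rewrite -wE /c -morphX //; apply: coset_id; apply/Lp/(L_sub _ (Lw j)); nat_lia.
rewrite /c -morphX // -morphR //; apply: coset_id.
have -> : i + p = i.-1 + p.+1 by nat_lia.
exact: lcn_comm.
Qed.

(* [p]-th powers yield [C k <= C (k + p - 1)]; both have index [p]. *)
Lemma centralizer2_shift k s : p < k -> k + p < n.+1 ->
    (forall a, a \in L k -> a \notin L k.+1 -> a ^+ p \notin L (k + p)) ->
  (k + p).-1.+1 < n -> s \notin centralizer2 k -> s \notin centralizer2 (k + p).-1.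
Proof.
move=> lt_pk le_kpn pow_k; set m := (k + p).-1 => lt_mn nCs.
have p_gt1 := prime_gt1 p_pr.
have mE : m.+1 = k + p by rewrite /m; nat_lia.
have [k_gt1 lt_kn] : 1 < k /\ k < n by split; nat_lia.
have [m_gt1 lt_mn'] : 1 < m /\ m < n by split; nat_lia.
have [a La nLa] := lcn_ex (ltnW k_gt1) lt_kn.
have Lb : a ^+ p \in L m by apply: lcn_power La; apply: ltnW.
have nLb : a ^+ p \notin L m.+1 by rewrite mE; apply: pow_k.
have Lpow x : x \in L k.+2 -> x ^+ p \in L m.+2.
  by apply: lcn_power_deep => //; nat_lia.
(* Modulo [L m.+2], [[~ a ^+ p, t]] is [[~ a, t] ^+ p]. *)
have sCC t : t \in centralizer2 k -> t \in centralizer2 m.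
  move=> /centralizer2P/(_ a La) Lat; apply: (centralizer2_mem m_gt1 lt_mn' Lb nLb).
  have /lcsP : lcs m.+2 ((a ^+ p * [~ a, t] ^+ p)^-1 * (a * [~ a, t]) ^+ p).
    apply: (@lcs_power_mul _ k.+2 p p) => //; try exact/lcsP.
    - exact: lcs_subgroup.
    - by move=> x; apply: lcs_leq; nat_lia.
    - by move=> x /lcsP Lx; apply/lcsP/Lpow/(L_sub _ Lx).
  rewrite -conj_mulR -conjXg invgM -mulgA -commgEl groupMl //.
  by rewrite groupV Lpow.
apply/negP => Cs.
have Lu : [~ a, s] \in L k.+1 by apply: lcn_commS.
have nLu : [~ a, s] \notin L k.+2.
  by apply: contra nCs; apply: centralizer2_mem La nLa.
(* Since [[~ a, s]] generates [L k.+1 / L k.+2], every [t] is a power of [s] times an element of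
   [centralizer2 k]. *)
have CT : centralizer2 m = G.
  apply/setP => t; rewrite in_setT.
  have lt_k1n : k.+1 < n by nat_lia.
  have [j [z Lz E]] := lcn_quo_cyclic (leqW k_gt1) lt_k1n Lu nLu (lcn_commS t La).
  set u := [~ a, s] in Lu nLu E.
  have Luj i : u ^+ i \in L k.+1 by rewrite groupX.
  have [w Lw wE] : exists2 w, w \in L k.+2 & [~ a, s ^+ j] = u ^+ j * w.
    elim: j {E} => [|j [w Lw wE]]; first by exists 1; rewrite ?group1 // commg1 mulg1.
    exists ([~ u ^+ j, s] * w ^ s); first by rewrite groupM ?lcnJ ?lcn_commS.
    by rewrite expgSr commgMJ -/u wE conjMg expgS (conj_mulR (u ^+ j) s) !mulgA.
  have tE : t = s ^+ j * ((s ^+ j)^-1 * t) by rewrite mulKVg.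
  set c := _ * t in tE.
  have Cc : c \in centralizer2 m.
    apply/sCC/(centralizer2_mem k_gt1 lt_kn La nLa).
    have -> : [~ a, c] = (z * (w ^ c)^-1 * [~ u ^+ j, c]^-1) ^ (u ^+ j)^-1.
      move: E; rewrite tE commgMJ wE conjMg [(u ^+ j) ^ c]conj_mulR => E.
      apply: (mulIg (u ^+ j * [~ u ^+ j, c] * w ^ c)); rewrite E.
      by group_norm.
    by rewrite lcnJ // !groupM ?groupV ?lcnJ ?lcn_commS.
  by rewrite tE groupM ?groupX.
have := centralizer2_proper (ltnW m_gt1) lt_mn; rewrite CT.
by rewrite -{2}[#|G|]muln1 leq_pmul2l ?cardG_gt0 // leqNgt p_gt1.
Qed.

(** The shift by [p - 1] starts from indices above [p], hence reaches [2p] and beyond; the [p]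
    indices from [p] to [2p - 1] are avoided by counting. *)
Lemma uniserial_element :
  exists s, forall k, p <= k -> k.+1 < n -> s \notin centralizer2 k.
Proof.
have p_gt1 := prime_gt1 p_pr.
pose ks := [seq k <- iota p p | k.+1 < n].
have ks_ok : {in ks, forall k, (0 < k) && (k.+1 < n)}.
  by move=> k; rewrite mem_filter mem_iota => /andP[-> /andP[le_pk _]]; rewrite andbT; nat_lia.
have le_ks : size ks <= p.
  by rewrite size_filter (leq_trans (count_size _ _)) ?size_iota.
have [s nCs] := avoid_centralizers ks_ok le_ks; exists s => k.
have [m] := ubnP k; elim: m k => // m IHm k lt_km le_pk lt_kn.
have [lt_k2p|le_2pk] := ltnP k (p + p).
  by apply: nCs; rewrite mem_filter mem_iota lt_kn le_pk.
have kE : (k.+1 - p + p).-1 = k by nat_lia.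
rewrite -kE; apply: centralizer2_shift; rewrite ?kE //; try nat_lia.
  apply: (@centralizer2_power _ s); try nat_lia.
  by rewrite kE => i le_pi lt_ik; apply: IHm; nat_lia.
by apply: IHm; nat_lia.
Qed.

(** Start in [L p.+1] outside [L p.+2]: each [p]-th power descends exactly [p - 1] steps, and [e] of
    them must reach the trivial group. *)
Lemma order_exponent_bound e : (forall x, x ^+ (p ^ e) = 1) -> n <= p.+1 + e * p.-1.
Proof.
move=> exp_e; rewrite leqNgt; apply/negP => lt_en.
have p_gt1 := prime_gt1 p_pr.
have [s nCs] := uniserial_element.
have lt_p1n : p.+1 < n by apply: leq_ltn_trans lt_en; apply: leq_addr.
have [a La nLa] := lcn_ex (ltn0Sn p) lt_p1n.
have : a ^+ (p ^ e) \notin L (p.+1 + e * p.-1).+1; last by rewrite exp_e group1.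
suff [] : a ^+ (p ^ e) \in L (p.+1 + e * p.-1) /\
          a ^+ (p ^ e) \notin L (p.+1 + e * p.-1).+1 by [].
elim: e lt_en {exp_e} => [|e IHe] lt_en; first by rewrite expn0 expg1 addn0.
have [|Lb nLb] := IHe.
  by apply: leq_ltn_trans lt_en; rewrite leq_add2l leq_mul2r leqnSn orbT.
rewrite expnSr expgnA; have -> : p.+1 + e.+1 * p.-1 = (p.+1 + e * p.-1 + p).-1.
  by rewrite mulSn; nat_lia.
move: lt_en; rewrite mulSn => lt_en.
set i := p.+1 + e * p.-1 in Lb nLb lt_en *.
split; first by apply: lcn_power.
have -> : (i + p).-1.+1 = i + p by nat_lia.
apply: (@centralizer2_power _ s) => //; rewrite /i; try nat_lia.
by move=> k le_pk lt_k; apply: nCs => //; nat_lia.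
Qed.

End LargeOrder.

(** * The exponent of [nu G] *)

Let lcs_nu_trivial (z : nu gT) : lcs n.+1 z -> z = 1.
Proof.
rewrite -(prednK (ltnW n_gt1)); apply: nu_lcs_trivial => x.
by rewrite prednK ?(ltnW n_gt1) // => /lcsP/lcn_trivial.
Qed.

Let nu_power q r : 1 < r -> (forall j, 0 < j < r -> q %| 'C(q, j)) ->
    (forall x : gT, lcs r (x ^+ q)) ->
  forall i (z : nu gT), 0 < i -> lcs i z -> lcs (i + r).-1 (z ^+ q).
Proof.
move=> r_gt1 dvd_q Lq; apply: lcs_power (nu_gen (G := gT)) _ => // _ [g [->|->]].
  by rewrite -(morph_expg (@nu_lM _)); apply: (lcs_morph (@nu_lM _)).
by rewrite -(morph_expg (@nu_rM _)); apply: (lcs_morph (@nu_rM _)).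
Qed.

Lemma nu_exponent_bound (z : nu gT) : z ^+ (bold_p p ^ 2 * exponent G) = 1.
Proof.
have p_gt1 := prime_gt1 p_pr.
have : p.-nat (exponent G) by rewrite pnat_exponent.
case/p_natP=> e eE; rewrite eE.
have exp_e (x : gT) : x ^+ (p ^ e) = 1 by rewrite -eE expg_exponent ?in_setT.
have [lt_pn|le_np] := ltnP p n.
  have zX m : lcs (m * p.-1).+1 (z ^+ (p ^ m)).
    elim: m => [|m IHm] //; rewrite expnSr expgnA.
    have -> : (m.+1 * p.-1).+1 = ((m * p.-1).+1 + p).-1.
      by rewrite mulSn addSn /= addnC -addnS prednK // ltnW.
    apply: nu_power => // [j|x]; first exact: prime_dvd_bin.
    by apply/lcsP; apply: (@lcn_power lt_pn 1) => //; apply: in_setT.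
  have le_ne := order_exponent_bound lt_pn exp_e.
  have boldE : (bold_p p ^ 2 * p ^ e = p ^ ((if p == 2 then 4 else 2) + e))%N.
    by rewrite /bold_p expnD; case: eqP => [->|_].
  rewrite boldE; apply: lcs_nu_trivial; apply: lcs_leq (zX _).
  (* With [m] extra factors [p] one needs [p.+1 <= m * p.-1]: [m = 2] does for odd [p], and [m = 4]
     for [p = 2]. *)
  case: eqP => p2; first by move: le_ne; rewrite p2 muln1; nat_lia.
  have p_gt2 : 2 < p by rewrite ltn_neqAle eq_sym p_gt1 andbT; apply/eqP.
  by rewrite mulnDl; nat_lia.
(* In [G] the [p ^ e]-th powers are trivial, so [nu_power] applies with the largest [r] for which
   [bin_dvd] holds. *)
have Lq : lcs p (z ^+ (p ^ e)).
  apply: (@nu_power (p ^ e) p p_gt1 _ _ 1) => // [j|x]; first exact: bin_dvd.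
  by rewrite exp_e; apply: (subgroup1 (lcs_subgroup _ _)).
(* With [r = 2] only ['C(q, 1)] matters, and [p ^ 2] is the order of [G / L 2]. *)
have Lq2 : lcs (p + 2).-1 (z ^+ (p ^ e) ^+ (p ^ 2)).
  apply: nu_power => // [j|x|]; last exact: ltnW.
    by case: j => [|[]] // _; rewrite bin1.
  have Ns y : y \in 'N(L 2) by apply: (subsetP (lcn_norm _ _)).
  apply/lcsP/coset_idr => //; rewrite morphX //.
  have <- : #|G / L 2| = (p ^ 2)%N by rewrite card_quo lL_E // (subKn n_gt1).
  by apply: expg_cardG; apply: mem_quotient.
have z1 : z ^+ (p ^ e) ^+ (p ^ 2) = 1 by apply: lcs_nu_trivial; apply: lcs_leq Lq2; nat_lia.
have /dvdnP[d ->] : p ^ 2 %| bold_p p ^ 2 by rewrite /bold_p; case: eqP => [->|].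
by rewrite -mulnA [(p ^ 2 * _)%N]mulnC mulnC expgnA expgnA z1 expg1n.
Qed.

End MaximalClassGroups.

Theorem corollary1p3 (p : nat) (gT : finGroupType) :
  prime p -> maximal_class p [set: gT]%G ->
  group_exponent (nu gT) %| bold_p p ^ 2 * exponent [set: gT].
Proof.
move=> p_pr maxG; apply/group_exponent_dvdn; last first.
  exact: nu_exponent_bound.
rewrite muln_gt0 exponent_gt0 andbT expn_gt0 /bold_p.
by case: ifP => // _; rewrite prime_gt0.
Qed.
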